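(* Let $B\supseteq C$ be a unital inclusion of $C^*$-algebras, $\theta:C\to B$ an injective unital $*$-homomorphism, $E_C^B:B\to C$ and $E_{\theta(C)}^B:B\to\theta(C)$ non-degenerate conditional expectations, and $(A,E_B^A,u(\theta))=(B,E_C^B)\bigstar_C(\theta,E_{\theta(C)}^B)$ the reduced HNN extension. Assume that there are unitaries $a\in C'\cap B$, $b\in\theta(C)'\cap B$ such that $E_C^B(a)=E_{\theta(C)}^B(b)=0$ and that either $a\,\mathrm{Ker}E_C^B\,a^*\subseteq\mathrm{Ker}E_C^B$ or $b\,\mathrm{Ker}E_{\theta(C)}^B\,b^*\subseteq\mathrm{Ker}E_{\theta(C)}^B$ holds. If $C$ has no non-trivial $C^*$-ideal invariant under the actions of $\mathcal{N}^{(2)}(E_C^B)$ and $\mathcal{N}^{(2)}(E_{\theta(C)}^B)$ (by left-right multiplication), then $A$ must be simple.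
   Context: A conditional expectation $E:B\to C$ is non-degenerate if its GNS representation is faithful; equivalently, $E(x^*b^*bx)=0$ for all $x\in B$ implies $b=0$. $\mathcal{N}^{(2)}(E_C^B):=\{(x,y)\in B\times B: x\,\mathrm{Ker}E_C^B\,y\subseteq\mathrm{Ker}E_C^B,\ xCy\subseteq C\}$ and $\mathcal{N}^{(2)}(E_{\theta(C)}^B):=\{(x,y)\in B\times B: x\,\mathrm{Ker}E_{\theta(C)}^B\,y\subseteq\mathrm{Ker}E_{\theta(C)}^B,\ x\theta(C)y\subseteq\theta(C)\}$; they act by $z\mapsto xzy$. A closed two-sided ideal $C_0$ of $C$ is invariant under these actions if $xC_0y\subseteq C_0$ for all $(x,y)\in\mathcal{N}^{(2)}(E_C^B)$ and $x\theta(C_0)y\subseteq\theta(C_0)$ for all $(x,y)\in\mathcal{N}^{(2)}(E_{\theta(C)}^B)$. Non-trivial means different from $\{0\}$ and $C$. Reduced HNN extension. $(B,E_C^B)\bigstar_C(\theta,E_{\theta(C)}^B)$ is the unique triple $(A,E_B^A,u(\theta))$ consisting of a $C^*$-algebra $A\supseteq B$ (unital inclusion), a non-degenerate conditional expectation $E_B^A:A\to B$ and a unitary $u(\theta)\in A$, such that $A$ is generated as a $C^*$-algebra by $B$ and $u(\theta)$ and: (A) $u(\theta)\theta(c)u(\theta)^*=c$ for all $c\in C$; (M) $E_B^A(w)=0$ for every reduced word $w=u(\theta)^{\varepsilon_0}b_1u(\theta)^{\varepsilon_1}\cdots b_\ell u(\theta)^{\varepsilon_\ell}$ ($\ell\ge0$,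 $b_j\in B$, $\varepsilon_j=\pm1$), reduced meaning that for every $j$ with $\varepsilon_{j-1}\neq\varepsilon_j$: $b_j\in\mathrm{Ker}E_{\theta(C)}^B$ when $\varepsilon_{j-1}=1,\varepsilon_j=-1$, and $b_j\in\mathrm{Ker}E_C^B$ when $\varepsilon_{j-1}=-1,\varepsilon_j=1$. *)

(* Defs.v *)
From HB Require Import structures.
From mathcomp Require Import all_boot all_order all_algebra.
From mathcomp Require Import all_classical all_reals all_analysis.
From mathcomp Require Import complex.

Set Implicit Arguments.
Unset Strict Implicit.
Unset Printing Implicit Defensive.

Import Order.TTheory GRing.Theory Num.Theory.
Import numFieldNormedType.Exports.

Local Open Scope classical_set_scope.
Local Open Scope ring_scope.
Local Open Scope complex_scope.

(* Nonzero unital complex C*-algebras.  The norm is carried by the mixin because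
   Hierarchy Builder rejects a structure inheriting from both GRing.Algebra and
   NormedModule: its join with Num.NumDomain would be ambiguous.  The uniform
   structure is the one of the library, required to be induced by cnorm, and
   cstar_complete is Uniform_isComplete without its pointedness. *)
HB.mixin Record isCStarAlgebra (R : realType) A
    of Uniform A & GRing.Algebra R[i] A := {
  cnorm : A -> R;
  star : A -> A;
  entourage_cnorm : (entourage : set_system (A * A)) = entourage_ (ball_ cnorm);
  cstar_complete : forall F : set_system A, ProperFilter F -> cauchy F ->
    exists l : A, F --> l;
  cnormD : forall x y, cnorm (x + y) <= cnorm x + cnorm y;
  cnormZ : forall (k : R[i]) x, cnorm (k *: x) = complex.Re `|k| * cnorm x;
  cnorm0_eq0 : forall x, cnorm x = 0 -> x = 0;
  cnormM : forall x y, cnorm (x * y) <= cnorm x * cnorm y;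
  starK : forall x, star (star x) = x;
  starD : forall x y, star (x + y) = star x + star y;
  starZ : forall (k : R[i]) x, star (k *: x) = Num.conj k *: star x;
  starM : forall x y, star (x * y) = star y * star x;
  cstar_identity : forall x, cnorm (star x * x) = cnorm x ^+ 2
}.

#[short(type="cstarAlgType")]
HB.structure Definition CStarAlgebra (R : realType) :=
  {A of Uniform A & GRing.Algebra R[i] A & isCStarAlgebra R A}.

Section OneAlgebra.
Variables (R : realType) (B : cstarAlgType R).
Implicit Types (D J S : set B) (E : B -> B) (x y : B).

Record unital_cstar_subalgebra D : Prop := {
  csub_1 : D 1;
  csub_lin : forall (a : R[i]) x y, D x -> D y -> D (a *: x + y);
  csub_mul : forall x y, D x -> D y -> D (x * y);
  csub_star : forall x, D x -> D (star x);
  csub_closed : closed D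
}.

Record closed_ideal D J : Prop := {
  ideal_sub : J `<=` D;
  ideal_0 : J 0;
  ideal_lin : forall (a : R[i]) x y, J x -> J y -> J (a *: x + y);
  ideal_mull : forall d x, D d -> J x -> J (d * x);
  ideal_mulr : forall d x, D d -> J x -> J (x * d);
  ideal_closed : closed J
}.

Definition cstar_simple : Prop :=
  forall J, closed_ideal setT J -> J = [set 0] \/ J = setT.

Definition unitary x : Prop := star x * x = 1 /\ x * star x = 1.

Definition commutant S : set B := [set x | forall y, S y -> x * y = y * x].

Definition generates S : Prop :=
  forall D, unital_cstar_subalgebra D -> S `<=` D -> D = setT.

(* A conditional expectation of B onto D is a map B -> B with values in D.  The
   contractivity clause follows from the others; it is part of the usual
   definition. *)
Record cond_exp D E : Prop := {
  cexp_range : forall x, D (E x);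
  cexp_id : forall d, D d -> E d = d;
  cexp_linear : forall (a : R[i]) x y, E (a *: x + y) = a *: E x + E y;
  cexp_bimod : forall d x d', D d -> D d' -> E (d * x * d') = d * E x * d';
  cexp_pos : forall x, exists y, E (star x * x) = star y * y;
  cexp_contr : forall x, cnorm (E x) <= cnorm x
}.

(* The left-hand side of the implication says that b acts as 0 in the GNS
   representation of E, i.e. on the completion of B for <x, y> = E (x^* y). *)
Definition nondegenerate_cexp E : Prop :=
  forall b, (forall x, E (star x * star b * b * x) = 0) -> b = 0.

Definition Ker E : set B := [set x | E x = 0].

Definition lrmul x y S : set B := [set x * z * y | z in S].

Definition N2 D E : set (B * B) :=
  [set p | lrmul p.1 p.2 (Ker E) `<=` Ker E /\ lrmul p.1 p.2 D `<=` D].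

End OneAlgebra.

Section TwoAlgebras.
Variables (R : realType) (B A : cstarAlgType R).

(* f is only relevant on the subalgebra D. *)
Record unital_star_embedding (D : set B) (f : B -> A) : Prop := {
  semb_1 : f 1 = 1;
  semb_lin : forall (a : R[i]) x y, D x -> D y ->
    f (a *: x + y) = a *: f x + f y;
  semb_mul : forall x y, D x -> D y -> f (x * y) = f x * f y;
  semb_star : forall x, D x -> f (star x) = star (f x);
  semb_inj : forall x y, D x -> D y -> f x = f y -> x = y
}.

(* An exponent is encoded by a boolean: true is +1 and false is -1. *)
Definition upow (u : A) (e : bool) : A := if e then u else star u.

(* The word u^e0 b1 u^e1 ... bl u^el, for s = [:: (b1, e1); ...; (bl, el)]. *)
Definition hnn_word (iota : B -> A) (u : A) (e0 : bool) (s : seq (B * bool))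
    : A :=
  upow u e0 * \prod_(p <- s) (iota p.1 * upow u p.2).

Fixpoint reduced_word (EC Etheta : B -> B) (e0 : bool) (s : seq (B * bool))
    : Prop :=
  if s is (b, e) :: s' then
    [/\ (e0 = true -> e = false -> Ker Etheta b),
        (e0 = false -> e = true -> Ker EC b)
      & reduced_word EC Etheta e s']
  else True.

(* The inclusion of B in A is the embedding iota, and EB : A -> A is the
   conditional expectation onto the copy range iota of B. *)
Record reduced_HNN (C : set B) (EC : B -> B) (theta Etheta : B -> B)
    (iota : B -> A) (EB : A -> A) (u : A) : Prop := {
  hnn_iota : unital_star_embedding setT iota;
  hnn_cexp : cond_exp (range iota) EB;
  hnn_nondeg : nondegenerate_cexp EB;
  hnn_unitary : unitary u;
  hnn_gen : generates (range iota `|` [set u]);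
  hnn_A : forall c, C c -> u * iota (theta c) * star u = iota c;
  hnn_M : forall e0 s, reduced_word EC Etheta e0 s ->
    EB (hnn_word iota u e0 s) = 0
}.

End TwoAlgebras.

(* Main.v *)
(* Let J be a proper closed ideal of A, let psi = E_C E_B, and let beta be the span
   of the reduced words u ... u*.  Elements of beta map the words that do not start
   with u to words that do, and the unitaries u^j a move the latter to mutually
   orthogonal subspaces; averaging over these unitaries, as Powers did for free
   groups, shows that -1 is not a limit of elements p + j + y with p >= 0, j in J
   and y in beta.  So the elements c of C such that - c* c is such a limit form a
   proper closed ideal N of C.  Conjugation by a, by u b u* and by elements of
   ker E_C and of u (ker E_theta) u* exchanges beta with its counterpart alpha on
   the other side of the base edge of the Bass-Serre tree.  It follows that N is
   stable under c -> E_C (d* c d) and its analogue for theta, which makes N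
   invariant, hence zero: an element of C that is a limit as above is positive.

   Now let x be positive modulo J.  For every long v = u d_1 u d_2 ... u d_n the
   element v* x v is the sum of psi (v* x v) and of words that u b u* conjugates
   into beta, whence psi (v* x v) >= 0.  As E_C is nondegenerate, the d_i can be
   removed one by one, and psi x >= 0.  Applied to J = - J this gives psi (J) = 0,
   and nondegeneracy of E_C and E_B yields J = 0. *)

Require Import Defs.
From HB Require Import structures.
From mathcomp Require Import all_boot all_order all_algebra.
From mathcomp Require Import all_classical all_reals all_analysis.
From mathcomp Require Import complex.
From mathcomp Require Import ring lra.

Set Implicit Arguments.
Unset Strict Implicit.
Unset Printing Implicit Defensive.

Import Order.TTheory GRing.Theory Num.Theory.
Import numFieldNormedType.Exports.
Local Open Scope classical_set_scope.
Local Open Scope ring_scope.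

(** * Identities in noncommutative rings *)

(** The hypothesis on ideals concerns C, while J lives in A and need not contain any combination of
    words. What connects them is order: an inequality modulo J and modulo words is conjugated until
    only its part in C is left. Averaging copes with one side of the base edge, beta, since the u^j
    a spread apart the words that start with u. Conjugating by an element of ker E_C leads from beta
    to alpha, so a way back is needed, and it must not disturb the part in C. This is what a and u b
    u* provide: they are unitaries commuting with C, the first carrying beta into alpha, the second
    alpha into beta. A word can also have one end on each side of the edge, and then neither
    conjugation helps. Hence the compression by u d_1 ... u d_n, which shifts the edge along the
    axis of u until the word lies on one side. Only words in u alone and their adjoints resist, and
    u b u* takes these into beta too. Words are not selfadjoint, so inequalities are stated for real
    parts, by [accretive]. *)

Inductive ncexp :=
  | NVar of nat | NZero | NOne
  | NAdd of ncexp & ncexp | NOpp of ncexp | NMul of ncexp & ncexp.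

Fixpoint ncnorm (e : ncexp) : seq (bool * seq nat) :=
  match e with
  | NVar i => [:: (false, [:: i])]
  | NZero => [::]
  | NOne => [:: (false, [::])]
  | NAdd e1 e2 => ncnorm e1 ++ ncnorm e2
  | NOpp e1 => [seq (~~ m.1, m.2) | m <- ncnorm e1]
  | NMul e1 e2 =>
      [seq (m.1 (+) m'.1, m.2 ++ m'.2) | m <- ncnorm e1, m' <- ncnorm e2]
  end.

(** Coefficients are represented by repeating signed monomials, so collecting terms amounts to
    pairing off opposite ones. *)
Fixpoint nccancel (p : seq (bool * seq nat)) :=
  if p is m :: p' then
    let q := nccancel p' in
    if (~~ m.1, m.2) \in q then rem (~~ m.1, m.2) q else m :: q
  else [::].

Section NonCommutativeRing.
Variables (S : pzRingType) (env : seq S).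

Fixpoint nceval (e : ncexp) : S :=
  match e with
  | NVar i => nth 0 env i
  | NZero => 0
  | NOne => 1
  | NAdd e1 e2 => nceval e1 + nceval e2
  | NOpp e1 => - nceval e1
  | NMul e1 e2 => nceval e1 * nceval e2
  end.

Definition ncmon (m : bool * seq nat) : S :=
  (-1) ^+ m.1 * \prod_(i <- m.2) nth 0 env i.

Definition ncpol (p : seq (bool * seq nat)) : S := \sum_(m <- p) ncmon m.

Lemma ncmon_opp m : ncmon (~~ m.1, m.2) = - ncmon m.
Proof. by rewrite /ncmon signrN mulNr. Qed.

Lemma ncmon_mul m m' :
  ncmon (m.1 (+) m'.1, m.2 ++ m'.2) = ncmon m * ncmon m'.
Proof.
rewrite /ncmon big_cat signr_addb !mulrA; congr (_ * _).
by rewrite -!mulrA; congr (_ * _); rewrite -signr_odd commr_sign.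
Qed.

Lemma nceval_norm e : nceval e = ncpol (ncnorm e).
Proof.
rewrite /ncpol; elim: e => [i||| e1 IH1 e2 IH2 | e IH | e1 IH1 e2 IH2] /=.
- by rewrite big_seq1 /ncmon big_seq1 mul1r.
- by rewrite big_nil.
- by rewrite big_seq1 /ncmon big_nil mul1r.
- by rewrite big_cat IH1 IH2.
- by rewrite big_map IH -sumrN; apply: eq_bigr => m _; rewrite ncmon_opp.
- rewrite big_allpairs_dep IH1 IH2 mulr_suml; apply: eq_bigr => m _.
  by rewrite mulr_sumr; apply: eq_bigr => m' _; rewrite ncmon_mul.
Qed.

Lemma ncpol_cancel p : ncpol (nccancel p) = ncpol p.
Proof.
rewrite /ncpol; elim: p => [//|m p IH] /=; rewrite big_cons -IH.
case: ifP => [min|_]; last by rewrite big_cons.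
by rewrite [in RHS](big_rem _ min) /= ncmon_opp addrA subrr add0r.
Qed.

Lemma nceval_eq e1 e2 :
  nilp (nccancel (ncnorm (NAdd e1 (NOpp e2)))) -> nceval e1 = nceval e2.
Proof.
move=> /nilP h; apply/eqP; rewrite -subr_eq0.
have := nceval_norm (NAdd e1 (NOpp e2)).
by rewrite -ncpol_cancel h /ncpol big_nil => /= ->.
Qed.

End NonCommutativeRing.

Ltac nc_find_syn x l :=
  match l with
  | x :: _ => constr:(0%N)
  | _ :: ?l' => let n := nc_find_syn x l' in constr:(n.+1)
  end.

(** The [match goal] makes [unify] run while a term is being built; its failure passes on to the
    next atom. *)
Ltac nc_find_conv x l :=
  match l with
  | ?y :: _ => let _ := match goal with _ => unify x y end in constr:(0%N)
  | _ :: ?l' => let n := nc_find_conv x l' in constr:(n.+1)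
  end.

Ltac nc_find x l :=
  match goal with
  | _ => nc_find_syn x l
  | _ => nc_find_conv x l
  end.

Ltac nc_add x l :=
  match goal with
  | _ => let n := nc_find x l in constr:(l)
  | _ => constr:(x :: l)
  end.

Ltac nc_atoms x l :=
  match x with
  | @GRing.mul _ ?a ?b => let l' := nc_atoms a l in nc_atoms b l'
  | @GRing.add _ ?a ?b => let l' := nc_atoms a l in nc_atoms b l'
  | @GRing.opp _ ?a => nc_atoms a l
  | @GRing.zero _ => constr:(l)
  | @GRing.one _ => constr:(l)
  | _ => nc_add x l
  end.

Ltac nc_reify x l :=
  match x with
  | @GRing.mul _ ?a ?b =>
      let a' := nc_reify a l in let b' := nc_reify b l in constr:(NMul a' b')
  | @GRing.add _ ?a ?b =>
      let a' := nc_reify a l in let b' := nc_reify b l in constr:(NAdd a' b')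
  | @GRing.opp _ ?a => let a' := nc_reify a l in constr:(NOpp a')
  | @GRing.zero _ => constr:(NZero)
  | @GRing.one _ => constr:(NOne)
  | _ => let n := nc_find x l in constr:(NVar n)
  end.

Ltac ncring :=
  match goal with
  | |- @eq ?T ?x ?y =>
    let l := nc_atoms x (@nil T) in
    let l := nc_atoms y l in
    let ex := nc_reify x l in
    let ey := nc_reify y l in
    apply: (@nceval_eq _ l ex ey); vm_compute; reflexivity
  end.

(** * C*-algebras: norm, square roots and positivity *)

Section CStarBasics.
Variables (R : realType) (A : cstarAlgType R).
Implicit Types (p q x y z : A) (r e M : R).

(** Real scalars as elements of the ring: [ncring] understands products but takes [*:] as an atom.
    Centrality is applied by hand through [rsC] and [rsCA]. *)
Definition rs r : A := r%:C%C *: 1.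

Lemma rs0 : rs 0 = 0.
Proof. by rewrite /rs rmorph0 scale0r. Qed.

Lemma rs1 : rs 1 = 1.
Proof. by rewrite /rs rmorph1 scale1r. Qed.

Lemma rsD r e : rs (r + e) = rs r + rs e.
Proof. by rewrite /rs rmorphD scalerDl. Qed.

Lemma rsN r : rs (- r) = - rs r.
Proof. by rewrite /rs rmorphN scaleNr. Qed.

Lemma rsB r e : rs (r - e) = rs r - rs e.
Proof. by rewrite rsD rsN. Qed.

Lemma rsM r e : rs (r * e) = rs r * rs e.
Proof. by rewrite /rs rmorphM -scalerAl mul1r scalerA. Qed.

Lemma rsC r x : x * rs r = rs r * x.
Proof. by rewrite /rs -scalerAl -scalerAr mulr1 mul1r. Qed.

Lemma rsE r x : rs r * x = r%:C%C *: x.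
Proof. by rewrite /rs -scalerAl mul1r. Qed.

Lemma rsCA r x y : x * (rs r * y) = rs r * (x * y).
Proof. by rewrite mulrA rsC mulrA. Qed.

Lemma rs_half x : rs 2^-1 * (x + x) = x.
Proof.
have -> : x + x = rs 2 * x by rewrite -[2%R]/(1 + 1 : R) rsD rs1 mulrDl !mul1r.
by rewrite mulrA -rsM mulVf ?pnatr_eq0 // rs1 mul1r.
Qed.

Lemma star0 : star (0 : A) = 0.
Proof. by apply: (addIr (star (0 : A))); rewrite -starD !add0r. Qed.

Lemma starN x : star (- x) = - star x.
Proof. by apply: (addIr (star x)); rewrite -starD !addNr star0. Qed.

Lemma starB x y : star (x - y) = star x - star y.
Proof. by rewrite starD starN. Qed.

Lemma star1 : star (1 : A) = 1.
Proof. by rewrite -[RHS]starK -[star 1]mulr1 starM starK mulr1. Qed.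

Lemma star_rs r : star (rs r) = rs r.
Proof. by rewrite /rs starZ star1 conj_Creal // complex_real. Qed.

Lemma star_sqr x : star (star x * x) = star x * x.
Proof. by rewrite starM starK. Qed.

Lemma star_rsM r x : star (rs r * x) = rs r * star x.
Proof. by rewrite starM star_rs rsC. Qed.

Lemma cnorm_rsM r x : cnorm (rs r * x) = `|r| * cnorm x.
Proof. by rewrite rsE cnormZ normc_def /= expr0n addr0 sqrtr_sqr. Qed.

Lemma cnorm0 : cnorm (0 : A) = 0.
Proof. by rewrite -(mul0r (0 : A)) -[X in X * _]rs0 cnorm_rsM normr0 mul0r. Qed.

Lemma cnormN x : cnorm (- x) = cnorm x.
Proof. by rewrite -mulN1r -rs1 -rsN cnorm_rsM normrN normr1 mul1r. Qed.

Lemma cnormBC x y : cnorm (x - y) = cnorm (y - x).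
Proof. by rewrite -cnormN opprB. Qed.

Lemma cnormB x y : cnorm (x - y) <= cnorm x + cnorm y.
Proof. by rewrite -(cnormN y) cnormD. Qed.

Lemma cnorm_ge0 x : 0 <= cnorm x.
Proof. by have := cnormB x x; rewrite subrr cnorm0; lra. Qed.

Lemma cnorm_tri y x z : cnorm (x - z) <= cnorm (x - y) + cnorm (y - z).
Proof. by have := cnormD (x - y) (y - z); rewrite addrA subrK. Qed.

Lemma cnorm1 : cnorm (1 : A) = 1.
Proof.
have h : cnorm (1 : A) = cnorm (1 : A) ^+ 2.
  by rewrite -cstar_identity star1 mulr1.
have : cnorm (1 : A) != 0 by apply/eqP => /cnorm0_eq0 /eqP; rewrite oner_eq0.
by move=> n0; apply: (mulfI n0); rewrite mulr1 -expr2 -h.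
Qed.

Lemma cnorm_rs r : cnorm (rs r) = `|r|.
Proof. by rewrite -(mulr1 (rs r)) cnorm_rsM cnorm1 mulr1. Qed.

Lemma cnorm_star x : cnorm (star x) = cnorm x.
Proof.
have le y : cnorm y <= cnorm (star y).
  have := cnormM (star y) y; rewrite cstar_identity expr2.
  case: (eqVneq (cnorm y) 0) => [->|n0]; first by rewrite cnorm_ge0.
  by rewrite ler_pM2r // lt_def n0 cnorm_ge0.
by apply/eqP; rewrite eq_le le andbT -{2}(starK x) le.
Qed.

Lemma cnorm_sqr x : star x = x -> cnorm (x * x) = cnorm x ^+ 2.
Proof. by move=> xs; rewrite -cstar_identity xs. Qed.

Lemma star_sqr_eq0 x : star x * x = 0 -> x = 0.
Proof.
move=> h; apply: cnorm0_eq0; apply/eqP.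
by have /eqP := cstar_identity x; rewrite h cnorm0 eq_sym expf_eq0.
Qed.

Lemma nbhs_cnorm x (U : set A) :
  nbhs x U <-> exists2 e, 0 < e & forall y, cnorm (x - y) < e -> U y.
Proof.
rewrite nbhsE; split.
- move=> [V [Vo Vx] VU].
  have : nbhs x V by exact: open_nbhs_nbhs.
  rewrite -nbhs_entourageE => -[E]; rewrite entourage_cnorm => -[e /= e0 hE] hV.
  exists e => // y hy; apply/VU/hV; rewrite /xsection /= inE; apply: hE.
  exact: hy.
- move=> [e e0 he].
  have : nbhs x U.
    rewrite -nbhs_entourageE; exists [set p | cnorm (p.1 - p.2) < e].
      by rewrite entourage_cnorm; exists e => //= p.
    by move=> y; rewrite /xsection /= inE => /he.
  by rewrite nbhsE.
Qed.

Lemma closure_cnorm (S : set A) x :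
  closure S x <-> forall e, 0 < e -> exists2 y, S y & cnorm (x - y) < e.
Proof.
split=> [cl e e0|h U /nbhs_cnorm[e e0 he]].
  have /cl[y [Sy /= xy]] : nbhs x [set y | cnorm (x - y) < e].
    by apply/nbhs_cnorm; exists e.
  by exists y.
by have [y Sy /he Uy] := h e e0; exists y.
Qed.

Lemma closed_cnorm (S : set A) :
  closed S <-> forall x, (forall e, 0 < e -> exists2 y, S y & cnorm (x - y) < e) -> S x.
Proof.
split=> [cS x h|h x /closure_cnorm]; last exact: h.
by apply: cS; apply/closure_cnorm.
Qed.

(** The hypothesis makes s nondecreasing; being bounded, it comes close to its supremum, so v is
    Cauchy. *)
Lemma cnorm_seq_lim (v : nat -> A) (s : nat -> R) M :
  (forall n, cnorm (v n.+1 - v n) <= s n.+1 - s n) -> (forall n, s n <= M) ->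
  exists l, forall e, 0 < e -> exists N, forall n, (N <= n)%N -> cnorm (l - v n) < e.
Proof.
move=> hv hs.
have hsm m n : (m <= n)%N -> cnorm (v n - v m) <= s n - s m.
  move/subnK => <-; elim: (n - m)%N => [|k IH]; first by rewrite !subrr cnorm0.
  by rewrite addSn; apply: le_trans (cnorm_tri (v (k + m)%N) _ _) _; have := hv (k + m)%N; lra.
have hc e : 0 < e -> exists N, forall n, (N <= n)%N -> s n - s N < e.
  move=> e0; have [|x [n _ <-] hx] := @sup_adherent _ (range s) e e0.
    by split; [exists (s 0%N), 0%N | exists M => _ [n _ <-]].
  exists n => m _; suff : s m <= sup (range s) by lra.
  by apply: ub_le_sup; [exists M => _ [k _ <-] | exists m].
have [] := @cstar_complete R A (v @ \oo)%classic _ _.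
  move=> E; rewrite /= entourage_cnorm => -[e /= e0 hE].
  have [N hN] := hc (e / 2) ltac:(by rewrite divr_gt0).
  have FN : (v @ \oo)%classic [set x | cnorm (x - v N) < e / 2].
    exists N => // n /= Nn.
    exact: le_lt_trans (hsm _ _ Nn) (hN _ Nn).
  exists ([set x | cnorm (x - v N) < e / 2], [set x | cnorm (x - v N) < e / 2]) => //=.
  move=> [x y] /= [hx hy]; apply: hE => /=.
  by apply: le_lt_trans (cnorm_tri (v N) _ _) _; rewrite (cnormBC _ y); lra.
move=> l hl; exists l => e e0.
have : nbhs l [set y | cnorm (l - y) < e] by apply/nbhs_cnorm; exists e.
by move=> /hl[N _ hN]; exists N => n Nn; exact: hN.
Qed.

Lemma cnorm_small x M : (forall e, 0 < e -> cnorm x <= M * e) -> x = 0.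
Proof.
move=> h; apply: cnorm0_eq0; apply/eqP; rewrite eq_le cnorm_ge0 andbT.
have M0 : 0 < `|M| + 1 by rewrite ltr_pwDr.
apply/ler_addgt0Pr => e e0; rewrite add0r; apply: le_trans (h (e / (`|M| + 1)) _) _.
  by rewrite divr_gt0.
rewrite mulrCA ler_piMr ?(ltW e0) // ler_pdivrMr // mul1r.
by apply: le_trans (ler_norm _) _; rewrite lerDl.
Qed.

Section Subalgebra.
Variable D : set A.
Hypothesis hD : unital_cstar_subalgebra D.

Lemma csub_0 : D 0.
Proof. by have := csub_lin hD (-1) (csub_1 hD) (csub_1 hD); rewrite scaleN1r addNr. Qed.

Lemma csub_add x y : D x -> D y -> D (x + y).
Proof. by move=> Dx; rewrite -[x]scale1r; exact: csub_lin. Qed.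

Lemma csub_scale k x : D x -> D (k *: x).
Proof. by move=> Dx; rewrite -[_ *: _]addr0; apply: csub_lin => //; exact: csub_0. Qed.

Lemma csub_sub x y : D x -> D y -> D (x - y).
Proof. by move=> Dx Dy; rewrite -scaleN1r; apply: csub_add => //; exact: csub_scale. Qed.

Lemma csub_rsM r x : D x -> D (rs r * x).
Proof. by rewrite rsE; exact: csub_scale. Qed.

End Subalgebra.

Fact rs_midpoint x : rs 2^-1 * x + rs 2^-1 * x = x.
Proof. by rewrite -mulrDr rs_half. Qed.

Section SquareRoot.
Variable h : A.
Hypotheses (hs : star h = h) (h1 : cnorm h <= 1).

(* The iteration q -> (h + q^2) / 2 converges to 1 - sqrt (1 - h); its increments
   are dominated by those of the same scalar iteration with h = 1. *)
Let v n := iter n (fun q => rs 2^-1 * (h + q * q)) 0.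
Let s n : R := iter n (fun r => 2^-1 * (1 + r * r)) 0.

Let vS n : v n.+1 = rs 2^-1 * (h + v n * v n). Proof. by []. Qed.
Let sS n : s n.+1 = 2^-1 * (1 + s n * s n). Proof. by []. Qed.

Let s_bd n : 0 <= s n <= 1.
Proof. by elim: n => [|n IH]; [rewrite /s /= lexx ler01 | rewrite sS; nra]. Qed.

Let v_comm x n : x * h = h * x -> x * v n = v n * x.
Proof.
move=> xh; elim: n => [|n IH]; first by rewrite /v /= mulr0 mul0r.
rewrite vS rsCA -mulrA; congr (_ * _).
by rewrite mulrDr mulrDl xh !mulrA IH -!mulrA IH.
Qed.

Let v_star n : star (v n) = v n.
Proof. by elim: n => [|n IH]; rewrite ?star0 // vS star_rsM starD starM hs IH. Qed.

Let v_sub D n : unital_cstar_subalgebra D -> D h -> D (v n).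
Proof.
move=> hD Dh; elim: n => [|n IH]; first exact: csub_0 hD.
by rewrite vS; apply/(csub_rsM hD)/(csub_add hD) => //; exact: csub_mul.
Qed.

Let v_bd n : cnorm (v n) <= s n.
Proof.
elim: n => [|n IH]; first by rewrite cnorm0.
rewrite vS cnorm_rsM sS ger0_norm ?invr_ge0 // ler_pM2l ?invr_gt0 //.
apply: le_trans (cnormD _ _) _; apply: lerD => //.
by apply: le_trans (cnormM _ _) _; apply: ler_pM => //; exact: cnorm_ge0.
Qed.

Let v_cauchy n : cnorm (v n.+1 - v n) <= s n.+1 - s n.
Proof.
elim: n => [|n IH]; first by have := v_bd 1; rewrite /s /v /= !subr0.
(* The iterates are polynomials in h, hence commute, and the difference of squares factors. *)
have -> : v n.+2 - v n.+1 = rs 2^-1 * ((v n.+1 + v n) * (v n.+1 - v n)).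
  have cvv : v n.+1 * v n = v n * v n.+1.
    by apply/v_comm/esym/v_comm.
  have -> : v n.+2 - v n.+1 = rs 2^-1 * (h + v n.+1 * v n.+1) - rs 2^-1 * (h + v n * v n) by [].
  rewrite -mulrBr; congr (_ * _).
  by rewrite mulrDl !mulrBr cvv; ncring.
rewrite cnorm_rsM ger0_norm ?invr_ge0 //.
have -> : s n.+2 - s n.+1 = 2^-1 * ((s n.+1 + s n) * (s n.+1 - s n)).
  have -> : s n.+2 - s n.+1 = 2^-1 * (1 + s n.+1 * s n.+1) - 2^-1 * (1 + s n * s n) by [].
  by ring.
rewrite ler_pM2l ?invr_gt0 //.
apply: le_trans (cnormM _ _) _; apply: ler_pM IH; rewrite ?cnorm_ge0 //.
by apply: le_trans (cnormD _ _) _; apply: lerD.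
Qed.

Lemma sqrt_one_minus : exists q, [/\ star q = q, q * q = 1 - h,
  cnorm (1 - q) <= 1,
  forall D, unital_cstar_subalgebra D -> D h -> D q
  & forall x, x * h = h * x -> x * q = q * x].
Proof.
have s1 n : s n <= 1 by have /andP[] := s_bd n.
have [l hl] := cnorm_seq_lim v_cauchy s1.
have v1 n : cnorm (v n) <= 1 by exact: le_trans (v_bd n) (s1 n).
have l1 : cnorm l <= 1.
  apply/ler_addgt0Pr => e e0; have [N /(_ N (leqnn _)) hN] := hl e e0.
  by have := cnormD (l - v N) (v N); have := v1 N; rewrite subrK; lra.
exists (1 - l); split.
- rewrite starB star1; congr (1 - _); apply/eqP; rewrite -subr_eq0; apply/eqP.
  apply: (@cnorm_small _ 2) => e /hl[N /(_ N (leqnn _)) hN].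
  have -> : star l - l = star (l - v N) - (l - v N).
    by rewrite starB v_star; ncring.
  by apply: le_trans (cnormB _ _) _; rewrite cnorm_star; lra.
- suff e : l + l - h - l * l = 0.
    have -> : (1 - l) * (1 - l) = 1 - h - (l + l - h - l * l) by ncring.
    by rewrite e subr0.
  apply: (@cnorm_small _ 4) => e /hl[N hN].
  have vv : v N.+1 + v N.+1 = h + v N * v N by rewrite vS rs_midpoint.
  have -> : l + l - h - l * l =
      (l - v N.+1) + (l - v N.+1) - ((l - v N) * l + v N * (l - v N)).
    have -> : h = v N.+1 + v N.+1 - v N * v N by rewrite vv addrK.
    by ncring.
  have h2 := hN N (leqnn _); have h3 := hN N.+1 (leqnSn _).
  apply: le_trans (cnormB _ _) _.
  have := cnormD (l - v N.+1) (l - v N.+1).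
  have := cnormD ((l - v N) * l) (v N * (l - v N)).
  have := cnormM (l - v N) l; have := cnormM (v N) (l - v N).
  have := v1 N; have := cnorm_ge0 (l - v N); have := cnorm_ge0 l.
  have := cnorm_ge0 (v N); nra.
- by rewrite opprB addrC subrK.
- move=> D hD Dh; have Dl : D l.
    apply: (proj1 (closed_cnorm D) (csub_closed hD)) => e /hl[N hN].
    by exists (v N); [exact: v_sub | exact: hN].
  by apply: (csub_sub hD) => //; exact: csub_1 hD.
- move=> x xh; rewrite mulrBl mulrBr mul1r mulr1; congr (x - _).
  apply/eqP; rewrite -subr_eq0; apply/eqP.
  apply: (@cnorm_small _ (2 * cnorm x)) => e /hl[N /(_ N (leqnn _)) hN].
  have -> : x * l - l * x = x * (l - v N) - (l - v N) * x.
    by rewrite mulrBr mulrBl (v_comm _ xh); ncring.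
  apply: le_trans (cnormB _ _) _.
  have := cnormM x (l - v N); have := cnormM (l - v N) x.
  have := cnorm_ge0 (l - v N); have := cnorm_ge0 x; nra.
Qed.

End SquareRoot.

(* p is the real part of p + i q, whose norm squared is |p^2 + q^2|. *)
Lemma cnorm_sum_sqr p q : star p = p -> star q = q -> p * q = q * p ->
  cnorm p ^+ 2 <= cnorm (p * p + q * q).
Proof.
move=> ps qs pq; pose v := p + 'i *: q.
have sv : star v = p - 'i *: q by rewrite starD starZ conjCi ps qs scaleNr.
have -> : p * p + q * q = star v * v.
  have ii : 'i * 'i = -1 :> R[i] by rewrite -expr2 sqrCi.
  rewrite sv /v mulrBl !mulrDr -!(scalerAl, scalerAr) pq scalerA ii.
  by rewrite scaleN1r opprB addrA addrAC addrK.
rewrite cstar_identity lerXn2r ?nnegrE ?cnorm_ge0 //.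
have <- : rs 2^-1 * (v + star v) = p.
  rewrite sv /v -[RHS]rs_half; congr (_ * _); ncring.
rewrite cnorm_rsM ger0_norm ?invr_ge0 //.
by have := cnormD v (star v); rewrite cnorm_star; lra.
Qed.

(** With k the square root of 1 - h^2, |1 - h^2| = |k|^2 <= |k^2 + h^2| = 1. *)
Lemma cnorm_one_minus_sqr (h : A) : star h = h -> cnorm h <= 1 ->
  cnorm (1 - h * h) <= 1.
Proof.
move=> hs h1; have [||k [ks kk _ _ kc]] := @sqrt_one_minus (h * h).
- by rewrite starM hs.
- by rewrite cnorm_sqr // expr_le1 ?cnorm_ge0.
have kh : k * h = h * k by apply/esym/kc; rewrite mulrA.
have := cnorm_sum_sqr ks hs kh.
by rewrite -(cnorm_sqr ks) kk subrK cnorm1.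
Qed.

(** For selfadjoint x this says that the spectrum lies in [0, 2M]. In this form sums are handled by
    the triangle inequality, and for M > 0 the square root series applies to x / M = 1 - (1 - x /
    M). *)
Definition cpos x : Prop := star x = x /\ exists M, cnorm (rs M - x) <= M.

Lemma cpos_star x : cpos x -> star x = x. Proof. by case. Qed.

Lemma cpos0 : cpos 0.
Proof. by split; [exact: star0 | exists 0; rewrite rs0 subr0 cnorm0]. Qed.

Lemma cpos_sqrt x : cpos x -> exists q, [/\ cpos q, q * q = x,
  forall D, unital_cstar_subalgebra D -> D x -> D q
  & forall y, y * x = x * y -> y * q = q * y].
Proof.
move=> [xs [M hM]]; have M0 : 0 <= M by apply: le_trans hM; exact: cnorm_ge0.
case: (eqVneq M 0) => [M0'|Mn0].
  have x0 : x = 0.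
    apply: cnorm0_eq0; apply/eqP; rewrite eq_le cnorm_ge0 andbT.
    by move: hM; rewrite M0' rs0 sub0r cnormN.
  rewrite x0; exists 0; split.
  - exact: cpos0.
  - by rewrite mulr0.
  - by [].
  - by move=> y _; rewrite mulr0 mul0r.
have Mp : 0 < M by rewrite lt_def Mn0.
pose y := rs M^-1 * x; have Mx : rs M * y = x.
  by rewrite /y mulrA -rsM mulfV // rs1 mul1r.
have [||q [qs qq q1 qD qc]] := @sqrt_one_minus (1 - y).
- by rewrite starB star1 /y star_rsM xs.
- have -> : 1 - y = rs M^-1 * (rs M - x).
    by rewrite mulrBr -rsM mulVf // rs1.
  by rewrite cnorm_rsM ger0_norm ?invr_ge0 // mulrC ler_pdivrMr // mul1r.
pose r := Num.sqrt M; have r0 : 0 <= r by exact: sqrtr_ge0.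
exists (rs r * q); split.
- split; first by rewrite star_rsM qs.
  exists r; have -> : rs r - rs r * q = rs r * (1 - q) by rewrite mulrBr mulr1.
  by rewrite cnorm_rsM ger0_norm // ler_piMr.
- rewrite -mulrA rsCA (mulrA (rs r) (rs r)) -rsM -expr2 sqr_sqrtr // qq opprB addrC subrK.
  exact: Mx.
- move=> D hD Dx; apply: (csub_rsM hD); apply: (qD _ hD).
  by apply: (csub_sub hD); [exact: csub_1 hD | exact: csub_rsM].
- move=> z zx; rewrite rsCA qc ?mulrA // mulrBr mulrBl mulr1 mul1r.
  by rewrite /y rsCA zx mulrA.
Qed.

Lemma cpos_sqr_bound q M : star q = q -> cnorm (q * q) <= M ->
  cnorm (rs M - q * q) <= M.
Proof.
move=> qs; have := cnorm_ge0 (q * q); rewrite le_eqVlt => /orP[/eqP h|h] hM.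
  by rewrite (@cnorm0_eq0 _ _ (q * q)) // subr0 cnorm_rs ger0_norm // h.
have M0 : 0 < M by exact: lt_le_trans hM.
pose r := (Num.sqrt M)^-1; have r0 : 0 <= r by rewrite invr_ge0 sqrtr_ge0.
have rr : r * r = M^-1 by rewrite -invfM -expr2 sqr_sqrtr // ltW.
pose k := rs r * q; have kk : k * k = rs M^-1 * (q * q).
  by rewrite /k -mulrA rsCA (mulrA (rs r) (rs r)) -rsM rr.
have -> : rs M - q * q = rs M * (1 - k * k).
  by rewrite mulrBr mulr1 kk (mulrA (rs M) (rs _)) -rsM mulfV ?gt_eqF // rs1 mul1r.
rewrite cnorm_rsM gtr0_norm // ler_piMr ?(ltW M0) //.
apply: cnorm_one_minus_sqr; first by rewrite /k star_rsM qs.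
rewrite -(@expr_le1 _ 2) ?cnorm_ge0 // -cnorm_sqr; last by rewrite /k star_rsM qs.
by rewrite kk cnorm_rsM gtr0_norm ?invr_gt0 // mulrC ler_pdivrMr // mul1r.
Qed.

Lemma cpos_sqr q : star q = q -> cpos (q * q).
Proof.
move=> qs; split; first by rewrite starM qs.
by exists (cnorm (q * q)); exact: cpos_sqr_bound.
Qed.

(** The witness M in [cpos] can be replaced by any bound of the norm. This uniformity is what allows
    the passage to the limit in [cpos_lim]. *)
Lemma cpos_bound x M : cpos x -> cnorm x <= M -> cnorm (rs M - x) <= M.
Proof.
by move=> /cpos_sqrt[q [[qs _] <- _ _]]; exact: cpos_sqr_bound.
Qed.

Lemma cposD x y : cpos x -> cpos y -> cpos (x + y).
Proof.
move=> [xs [M hM]] [ys [N hN]]; split; first by rewrite starD xs ys.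
exists (M + N); have -> : rs (M + N) - (x + y) = (rs M - x) + (rs N - y).
  by rewrite rsD; ncring.
by apply: le_trans (cnormD _ _) _; exact: lerD.
Qed.

Lemma cpos_rsM r x : 0 <= r -> cpos x -> cpos (rs r * x).
Proof.
move=> r0 [xs [M hM]]; split; first by rewrite star_rsM xs.
exists (r * M); rewrite rsM -mulrBr cnorm_rsM ger0_norm //.
exact: ler_wpM2l.
Qed.

Lemma cpos_rs r : 0 <= r -> cpos (rs r).
Proof.
by move=> r0; split; [exact: star_rs | exists r; rewrite subrr cnorm0].
Qed.

Lemma cpos_sum (I : Type) (s : seq I) (F : I -> A) :
  (forall i, cpos (F i)) -> cpos (\sum_(i <- s) F i).
Proof.
move=> h; elim: s => [|i s IH]; first by rewrite big_nil; exact: cpos0.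
by rewrite big_cons; exact: cposD.
Qed.

Lemma cpos_subr x M : star x = x -> cnorm x <= M -> cpos (rs M - x).
Proof.
move=> xs hM; split; first by rewrite starB star_rs xs.
by exists M; rewrite opprB addrC subrK.
Qed.

Lemma cpos_addr x M : star x = x -> cnorm x <= M -> cpos (rs M + x).
Proof.
by move=> xs hM; rewrite -[x]opprK; apply: cpos_subr; rewrite ?starN ?xs ?cnormN.
Qed.

Lemma cpos_lim x : star x = x -> (forall e, 0 < e -> cpos (x + rs e)) -> cpos x.
Proof.
move=> xs h; split=> //; exists (cnorm x); apply/ler_addgt0Pr => e e0.
have -> : rs (cnorm x) - x = rs (cnorm x + e) - (x + rs e).
  by rewrite rsD; ncring.
apply: cpos_bound (h e e0) _.
by apply: le_trans (cnormD _ _) _; rewrite cnorm_rs gtr0_norm.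
Qed.

(** The square roots p of x and q of -x commute and p^2 + q^2 = 0, so [cnorm_sum_sqr] gives p =
    0. *)
Lemma cpos_anti x : cpos x -> cpos (- x) -> x = 0.
Proof.
move=> /cpos_sqrt[p [[ps _] <- _ pc]] /cpos_sqrt[q [[qs _] qq _ qc]].
have pq : p * q = q * p by apply: qc; rewrite mulrN mulNr mulrA.
have := cnorm_sum_sqr ps qs pq; rewrite qq subrr cnorm0 => h.
apply: cnorm0_eq0; rewrite cnorm_sqr //; apply/eqP; rewrite eq_le h.
by rewrite exprn_ge0 // cnorm_ge0.
Qed.

Lemma cpos_le_cnorm x M : cpos x -> cpos (rs M - x) -> cnorm x <= M.
Proof.
move=> /cpos_sqrt[p [[ps _] pp _ _]] /cpos_sqrt[q [[qs _] qq _ qc]].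
have M0 : 0 <= M \/ M < 0 by case: (leP 0 M); [left | right].
have pq : p * q = q * p.
  by apply: qc; rewrite mulrBr mulrBl rsC -pp mulrA.
have := cnorm_sum_sqr ps qs pq; rewrite pp qq addrC subrK cnorm_rs.
rewrite -cnorm_sqr // pp.
case: M0 => M0; first by rewrite ger0_norm.
(* A negative M is impossible, being the sum of two positive elements. *)
move=> _; have h : x + (rs M - x) = - rs (- M) by rewrite rsN; ncring.
suff : rs (- M) = 0.
  by move=> /(congr1 (@cnorm _ _)); rewrite cnorm0 cnorm_rs normrN => /normr0P/eqP; lra.
apply: cpos_anti; first by apply: cpos_rs; rewrite oppr_ge0 ltW.
by rewrite -h -qq -{1}pp; apply: cposD; exact: cpos_sqr.
Qed.

(* n is twice the negative part of x, and z^2 = |x| n^2. *)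
Lemma negative_part x : star x = x -> exists z n,
  [/\ star z = z, star n = n, n * x * n = - (z * z), z = 0 -> cpos x
  & forall D, unital_cstar_subalgebra D -> D x -> D z /\ D n].
Proof.
move=> xs; have [a [apos aa aD ac]] := cpos_sqrt (cpos_sqr xs).
have [q [[qs _] qq qD qc]] := cpos_sqrt apos.
have as_ := cpos_star apos.
have xa : x * a = a * x by apply: ac; rewrite mulrA.
have qx : q * x = x * q by apply/esym/qc.
have qa : q * a = a * q by rewrite -qq mulrA.
pose n := a - x; have ns : star n = n by rewrite starB as_ xs.
have qn : q * n = n * q by rewrite mulrBr mulrBl qa qx.
have xn : x * n = - (a * n).
  by rewrite /n !mulrBr xa aa opprB.
exists (q * n), n; split=> //.
- by rewrite starM ns qs qn.
- by rewrite -mulrA xn mulrN {1}qn -qq -!mulrA.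
- move=> z0; have an : a * n = 0 by rewrite -qq -mulrA z0 mulr0.
  have nn : n * n = 0 by rewrite {1}/n mulrBl xn an oppr0 subrr.
  have n0 : n = 0 by apply: star_sqr_eq0; rewrite ns.
  by have /eqP := n0; rewrite subr_eq0 => /eqP <-.
- move=> D hD Dx; have Da : D a by apply: aD => //; exact: csub_mul.
  have Dn : D n by exact: csub_sub.
  by split=> //; apply: csub_mul => //; exact: qD.
Qed.

End CStarBasics.
(** * Positive and accretive elements *)

Section Positivity.
Variables (R : realType) (A : cstarAlgType R).
Implicit Types (p q x y z v : A) (r e M : R).

(* If n is the negative part of y* y and c = y n, then c* c = -z^2 <= 0, hence
   c c* >= 0; bounding c* (m - c c* ) c for m = |c|^2 from both sides forces
   m = 0. *)
Lemma cpos_star_mul y : cpos (star y * y).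
Proof.
have [z [n [zs ns nyn zpos _]]] := negative_part (star_sqr y).
apply: zpos; pose c := y * n.
have cc : star c * c = - (z * z) by rewrite -nyn /c starM ns !mulrA.
suff c0 : c = 0.
  by apply: star_sqr_eq0; apply/eqP; rewrite zs -oppr_eq0 -cc c0 mulr0.
pose m := cnorm c ^+ 2; pose g := z * z; pose W := c * star c.
have m0 : 0 <= m by rewrite exprn_ge0 ?cnorm_ge0.
have gpos : cpos g by exact: cpos_sqr.
have gs := cpos_star gpos.
have gE : g = - (star c * c) by rewrite cc opprK.
have gm : cnorm g = m by rewrite gE cnormN cstar_identity.
have Wpos : cpos W.
  (* P and Q are selfadjoint and (P^2 + Q^2) / 2 = c c* + c* c = W - g. *)
  pose P := c + star c; pose Q := 'i *: (c - star c).
  have Ps : star P = P by rewrite starD starK addrC.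
  have Qs : star Q = Q.
    by rewrite starZ conjCi starB starK -opprB scalerN scaleNr opprK.
  have -> : W = rs _ 2^-1 * (P * P + Q * Q) + g.
    have QQ : Q * Q = - ((c - star c) * (c - star c)).
      by rewrite /Q -scalerAl -scalerAr scalerA -expr2 sqrCi scaleN1r.
    have -> : P * P + Q * Q = (W - g) + (W - g) by rewrite QQ gE /W /P; ncring.
    by rewrite rs_half subrK.
  apply: cposD gpos; apply: cpos_rsM; first by rewrite invr_ge0.
  by apply: cposD; exact: cpos_sqr.
have Wm : cnorm (rs _ m - W) <= m.
  apply: cpos_bound Wpos _.
  by have := cstar_identity (star c); rewrite starK cnorm_star => ->.
pose T := rs _ m * g + g * g.
have Tm : cnorm T <= m ^+ 2.
  have -> : T = - (star c * (rs _ m - W) * c).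
    by rewrite mulrBr rsC /T /W gE; ncring.
  rewrite cnormN; apply: le_trans (cnormM _ _) _.
  apply: le_trans (ler_wpM2r (cnorm_ge0 _) (cnormM _ _)) _.
  rewrite cnorm_star mulrAC -expr2 -/m [in leRHS]expr2; exact: ler_wpM2l.
have Ts : star T = T by rewrite starD star_rsM (starM g g) gs.
have mg : cpos (rs _ m * g - g * g).
  have mgp : cpos (rs _ m - g) by apply: cpos_subr; rewrite ?gm.
  have [r [[rs_ _] rr _ rc]] := cpos_sqrt mgp.
  have zr : z * r = r * z.
    by apply: rc; rewrite mulrBl mulrBr rsC /g !mulrA.
  have -> : rs _ m * g - g * g = (z * r) * (z * r).
    rewrite -mulrBl -rr /g zr !mulrA -(mulrA r z r) zr !mulrA.
    by [].
  by apply: cpos_sqr; rewrite starM zs rs_ zr.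
(* 2 g^2 = T - (m g - g^2) <= T <= m^2, whereas |g^2| = m^2. *)
have h2 : cnorm (g * g + g * g) <= m ^+ 2.
  apply: cpos_le_cnorm; first by apply: cposD; apply: cpos_sqr.
  have -> : rs _ (m ^+ 2) - (g * g + g * g) =
      (rs _ (m ^+ 2) - T) + (rs _ m * g - g * g) by rewrite /T; ncring.
  by apply: cposD mg; exact: cpos_subr.
have h3 : cnorm (g * g + g * g) = 2 * m ^+ 2.
  have -> : g * g + g * g = rs _ 2 * (g * g).
    by rewrite -[2%R]/(1 + 1 : R) rsD rs1 mulrDl !mul1r.
  by rewrite cnorm_rsM cnorm_sqr // gm ger0_norm.
have /eqP : m = 0.
  have : m ^+ 2 <= 0 by move: h2; rewrite h3; lra.
  by rewrite le_eqVlt ltNge sqr_ge0 orbF expf_eq0 => /eqP.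
by rewrite expf_eq0 => /eqP/cnorm0_eq0.
Qed.

Lemma cpos_conj v x : cpos x -> cpos (star v * x * v).
Proof.
move=> /cpos_sqrt[q [[qs _] <- _ _]].
have -> : star v * (q * q) * v = star (q * v) * (q * v).
  by rewrite starM qs !mulrA.
exact: cpos_star_mul.
Qed.

(** Nonnegative real part: the order relation used for elements that are not selfadjoint, such as
    words. *)
Definition accretive x : Prop := cpos (x + star x).

Lemma accretive_cpos x : cpos x -> accretive x.
Proof. by move=> xp; rewrite /accretive (cpos_star xp); exact: cposD. Qed.

Lemma accretiveD x y : accretive x -> accretive y -> accretive (x + y).
Proof. by move=> hx hy; rewrite /accretive starD addrACA; exact: cposD. Qed.

Lemma accretive_rsM r x : 0 <= r -> accretive x -> accretive (rs A r * x).
Proof. by move=> r0 hx; rewrite /accretive star_rsM -mulrDr; exact: cpos_rsM. Qed.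

Lemma accretive_rs r : 0 <= r -> accretive (rs A r).
Proof. by move=> r0; exact/accretive_cpos/cpos_rs. Qed.

Lemma accretive_conj v x : accretive x -> accretive (star v * x * v).
Proof.
by move=> hx; rewrite /accretive !starM starK mulrA -mulrDl -mulrDr; exact: cpos_conj.
Qed.

Lemma accretive_star_mul v : accretive (star v * v).
Proof. exact/accretive_cpos/cpos_star_mul. Qed.

Lemma accretive_sum (I : Type) (s : seq I) (F : I -> A) :
  (forall i, accretive (F i)) -> accretive (\sum_(i <- s) F i).
Proof.
move=> h; elim: s => [|i s IH]; first by rewrite big_nil -(rs0 A); exact: accretive_rs.
by rewrite big_cons; exact: accretiveD.
Qed.

Lemma accretive_bound x M : cnorm x <= M -> accretive (rs A M + x).
Proof.
move=> hM; rewrite /accretive starD star_rs addrACA -rsD.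
apply: cpos_addr; first by rewrite starD starK addrC.
by apply: le_trans (cnormD _ _) _; rewrite cnorm_star lerD.
Qed.

Lemma accretive_lim x : (forall e, 0 < e -> accretive (x + rs A e)) -> accretive x.
Proof.
move=> h; apply: cpos_lim; first by rewrite starD starK addrC.
move=> e e0; have := h (e / 2) ltac:(by rewrite divr_gt0).
by rewrite /accretive starD star_rs addrACA -rsD -splitr.
Qed.

Lemma accretive_bound_star v M : cnorm v ^+ 2 <= M -> accretive (rs A M - star v * v).
Proof.
by move=> h; apply: accretive_bound; rewrite cnormN cstar_identity.
Qed.

(** Since 1 - w^(n+1) = (1 - w) + w (1 - w^n), all 1 - w^n lie in J, and they tend to 1. *)
Lemma closed_ideal_near_one (J : set A) w :
  closed_ideal setT J -> J (1 - w) -> cnorm w < 1 -> J 1.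
Proof.
move=> hJ Jw w1; have Jn n : J (1 - w ^+ n).
  elim: n => [|n IH]; first by rewrite subrr; exact: ideal_0 hJ.
  have -> : 1 - w ^+ n.+1 = (1 - w) + w * (1 - w ^+ n) by rewrite exprS; ncring.
  rewrite -[1 - w]scale1r; apply: (ideal_lin hJ) => //.
  exact: (ideal_mull hJ).
have wn n : cnorm (w ^+ n) <= cnorm w ^+ n.
  elim: n => [|n IH]; first by rewrite cnorm1.
  rewrite !exprS; apply: le_trans (cnormM _ _) _.
  by apply: ler_wpM2l => //; exact: cnorm_ge0.
apply: (proj1 (closed_cnorm J) (ideal_closed hJ)) => e e0.
have w1' : `|cnorm w| < 1 by rewrite ger0_norm ?cnorm_ge0.
have /cvgrPdist_lt/(_ e e0)[N _ hN] := cvg_expr w1'.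
exists (1 - w ^+ N); first exact: Jn.
rewrite subKr; apply: le_lt_trans (wn N) _.
have := hN N (leqnn N); rewrite sub0r normrN; apply: le_lt_trans.
exact: ler_norm.
Qed.

(** The real part of x is at most -e, so |1 + l x|^2 <= 1 - 2 e l + l^2 |x|^2, which is below 1 for
    the chosen l because l |x|^2 < e. Then 1 + l x plays the role of w in
    [closed_ideal_near_one]. *)
Lemma closed_ideal_accretive (J : set A) x e :
  closed_ideal setT J -> J x -> 0 < e -> accretive (- x - rs A e) -> J 1.
Proof.
move=> hJ Jx e0 hx; pose M := cnorm x ^+ 2; pose l := e / (M + 1).
have M0 : 0 <= M by rewrite exprn_ge0 ?cnorm_ge0.
have l0 : 0 < l by rewrite divr_gt0 ?ltr_wpDl.
have lM : l * M < e.
  by rewrite /l mulrAC ltr_pdivrMr ?ltr_wpDl // ltr_pM2l // ltrDl.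
apply: (@closed_ideal_near_one J (1 + rs A l * x)) => //.
  rewrite opprD addrA subrr sub0r rsE -scaleNr -[_ *: _]addr0.
  by apply: (ideal_lin hJ) => //; exact: ideal_0 hJ.
rewrite -(@expr_lt1 _ 2) ?cnorm_ge0 // -cstar_identity.
set z := 1 + _; apply: (@le_lt_trans _ _ (1 - 2 * e * l + l * l * M)); last by nra.
apply: cpos_le_cnorm; first exact: cpos_star_mul.
have zE : star z * z = 1 + rs A l * (x + star x) + rs A (l * l) * (star x * x).
  rewrite /z starD star1 star_rsM mulrDl mul1r mulrDr mulr1 -mulrA rsCA.
  by rewrite mulrA -rsM mulrDr; ncring.
have -> : rs A (1 - 2 * e * l + l * l * M) - star z * z =
   rs A l * ((- x - rs A e) + star (- x - rs A e)) +
   rs A (l * l) * (rs A M - star x * x).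
  rewrite zE starB starN star_rs !(rsD, rsN) rs1 !mulrBr !mulrDr !mulrN -!rsM.
  have -> : 2 * e * l = l * e + l * e by ring.
  rewrite rsD; ncring.
apply: cposD; first by apply: cpos_rsM => //; exact: ltW.
apply: cpos_rsM; first by rewrite mulr_ge0 // ltW.
by apply: cpos_subr; [exact: star_sqr | rewrite cstar_identity].
Qed.

End Positivity.

(** * Conditional expectations: positivity, adjoints and nondegeneracy *)

Section ConditionalExpectation.
Variables (R : realType) (A : cstarAlgType R) (D : set A) (E : A -> A).
Hypotheses (D1 : D 1) (hE : cond_exp D E).
Implicit Types (x y z v : A) (r e M : R).

Lemma cexpD x y : E (x + y) = E x + E y.
Proof. by have := cexp_linear hE 1 x y; rewrite !scale1r. Qed.

Lemma cexp0 : E 0 = 0.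
Proof. by apply: (addIr (E 0)); rewrite -cexpD !add0r. Qed.

Lemma cexpZ (k : R[i]) x : E (k *: x) = k *: E x.
Proof. by rewrite -[_ *: x]addr0 (cexp_linear hE) cexp0 addr0. Qed.

Lemma cexpN x : E (- x) = - E x.
Proof. by have := cexpZ (-1) x; rewrite !scaleN1r. Qed.

Lemma cexpB x y : E (x - y) = E x - E y.
Proof. by rewrite cexpD cexpN. Qed.

Lemma cexp_rsM r x : E (rs A r * x) = rs A r * E x.
Proof. by rewrite !rsE cexpZ. Qed.

Lemma cexp_ml d x : D d -> E (d * x) = d * E x.
Proof. by move=> Dd; rewrite -[d * x]mulr1 (cexp_bimod hE) // mulr1. Qed.

Lemma cexp_mr d x : D d -> E (x * d) = E x * d.
Proof. by move=> Dd; have := cexp_bimod hE x D1 Dd; rewrite !mul1r. Qed.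

Lemma cexp1 : E 1 = 1.
Proof. exact: (cexp_id hE). Qed.

Lemma cexp_rs r : E (rs A r) = rs A r.
Proof. by rewrite -[rs A r]mulr1 cexp_rsM cexp1. Qed.

Lemma cexp_idem x : E (E x) = E x.
Proof. by apply: (cexp_id hE); exact: cexp_range hE _. Qed.

Lemma cexp_cpos x : cpos x -> cpos (E x).
Proof.
move=> /cpos_sqrt[q [[qs _] <- _ _]]; rewrite -{1}qs.
by have [y ->] := cexp_pos hE q; exact: cpos_star_mul.
Qed.

Lemma cexp_sa x : star x = x -> star (E x) = E x.
Proof.
move=> xs; have /cexp_cpos/cpos_star := cpos_addr xs (lexx _).
by rewrite cexpD cexp_rs starD star_rs => /addrI.
Qed.

(** Positivity makes E preserve selfadjointness; apply this to x + x* and to i (x - x* ). *)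
Lemma cexp_star x : E (star x) = star (E x).
Proof.
have h1 : star (E x) + star (E (star x)) = E x + E (star x).
  by rewrite -starD -cexpD cexp_sa // starD starK addrC.
have h2 : star (E x) - star (E (star x)) = E (star x) - E x.
  have : star (E ('i *: (x - star x))) = E ('i *: (x - star x)).
    by apply: cexp_sa; rewrite starZ conjCi starB starK -opprB scalerN scaleNr opprK.
  rewrite cexpZ starZ conjCi cexpB starB scaleNr -scalerN opprB.
  by move=> /(scalerI (neq0Ci _))/(congr1 -%R); rewrite !opprB.
rewrite -(rs_half (star (E x))) -[LHS]rs_half; congr (_ * _).
have -> : star (E x) + star (E x) = star (E x) + star (E (star x)) +
  (star (E x) - star (E (star x))) by ncring.
by rewrite h1 h2; ncring.
Qed.

Lemma cexp_accretive x : accretive x -> accretive (E x).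
Proof. by move=> /cexp_cpos; rewrite cexpD cexp_star. Qed.

Hypothesis hnd : nondegenerate_cexp E.

(** Let n T n = - z^2 with n the negative part of T, the sum of x and its adjoint. Testing with n v
    shows that E(v* z* z v) is both positive and negative for every v, so nondegeneracy gives z =
    0. *)
Lemma nondegenerate_accretive x :
  (forall v, accretive (E (star v * x * v))) -> accretive x.
Proof.
move=> h; rewrite /accretive; set T := x + star x.
have Ts : star T = T by rewrite starD starK addrC.
have hT v : cpos (E (star v * T * v)).
  have := h v; rewrite /accretive -cexp_star -cexpD !starM starK.
  by rewrite mulrA -mulrDl -mulrDr.
have [z [n [zs ns nTn zpos _]]] := negative_part Ts.
apply: zpos; apply: hnd => v; apply: cpos_anti.
  apply: cexp_cpos; have -> : star v * star z * z * v = star (z * v) * (z * v).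
    by rewrite starM !mulrA.
  exact: cpos_star_mul.
have := hT (n * v); rewrite starM ns.
have -> : star v * n * T * (n * v) = star v * (n * T * n) * v by rewrite !mulrA.
by rewrite nTn mulrN mulNr cexpN zs !mulrA.
Qed.

End ConditionalExpectation.

(** * Reduced words *)

Section Span.
Variables (R : realType) (A : cstarAlgType R).
Implicit Types (S T : set A) (x y z : A).

Inductive lspan S : A -> Prop :=
  | lspan_in x : S x -> lspan S x
  | lspan0 : lspan S 0
  | lspanD x y : lspan S x -> lspan S y -> lspan S (x + y)
  | lspanZ (k : R[i]) x : lspan S x -> lspan S (k *: x).

Lemma lspan_rsM S r x : lspan S x -> lspan S (rs A r * x).
Proof. by rewrite rsE; exact: lspanZ. Qed.

Lemma lspanN S x : lspan S x -> lspan S (- x).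
Proof. by rewrite -scaleN1r; exact: lspanZ. Qed.

Lemma lspanB S x y : lspan S x -> lspan S y -> lspan S (x - y).
Proof. by move=> hx hy; apply: lspanD => //; exact: lspanN. Qed.

(* With phi = id or complex conjugation, f is linear or antilinear. *)
Lemma lspan_map S (V : A -> Prop) (phi : R[i] -> R[i]) (f : A -> A) :
  V 0 -> (forall x y, V x -> V y -> V (x + y)) ->
  (forall k x, V x -> V (k *: x)) ->
  (forall x y, f (x + y) = f x + f y) ->
  (forall k x, f (k *: x) = phi k *: f x) ->
  (forall x, S x -> V (f x)) -> forall x, lspan S x -> V (f x).
Proof.
move=> V0 VD VZ fD fZ fS x; elim=> [|| y z _ hy _ hz | k y _ hy] //.
- by have -> : f 0 = 0 by apply: (addIr (f 0)); rewrite -fD !add0r.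
- by rewrite fD; exact: VD.
- by rewrite fZ; exact: VZ.
Qed.

Lemma lspan_mul S T y z :
  (forall x, S x -> lspan T (y * x * z)) ->
  forall x, lspan S x -> lspan T (y * x * z).
Proof.
move=> h x; apply: (lspan_map (phi := id) (f := fun x => y * x * z)) => //.
- exact: lspan0.
- exact: lspanD.
- exact: lspanZ.
- by move=> a b; rewrite mulrDr mulrDl.
- by move=> k a; rewrite -scalerAr -scalerAl.
Qed.

Lemma lspan_star S T :
  (forall x, S x -> lspan T (star x)) ->
  forall x, lspan S x -> lspan T (star x).
Proof.
move=> h x; apply: (lspan_map (phi := Num.conj) (f := @star R A)) => //.
- exact: lspan0.
- exact: lspanD.
- exact: lspanZ.
- exact: starD.
- exact: starZ.
Qed.

Variables (D : set A) (E : A -> A).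
Hypothesis (hE : cond_exp D E).

Lemma lspan_cexp0 S y z : (forall x, S x -> E (y * x * z) = 0) ->
  forall x, lspan S x -> E (y * x * z) = 0.
Proof.
move=> h x; apply: (lspan_map (phi := id) (V := fun x => x = 0)
  (f := fun x => E (y * x * z))) => //.
- by move=> a b -> ->; rewrite addr0.
- by move=> k a ->; rewrite scaler0.
- by move=> a b; rewrite mulrDr mulrDl (cexpD hE).
- by move=> k a; rewrite -scalerAr -scalerAl (cexpZ hE).
Qed.

Lemma lspan_cexp0_star S y : (forall x, S x -> E (star x * y) = 0) ->
  forall x, lspan S x -> E (star x * y) = 0.
Proof.
move=> h x; apply: (lspan_map (phi := Num.conj) (V := fun x => x = 0)
  (f := fun x => E (star x * y))) => //.
- by move=> a b -> ->; rewrite addr0.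
- by move=> k a ->; rewrite scaler0.
- by move=> a b; rewrite starD mulrDl (cexpD hE).
- by move=> k a; rewrite starZ -scalerAl (cexpZ hE).
Qed.

Lemma lspan_orthogonal S T y : (forall x z, S x -> T z -> E (star x * y * z) = 0) ->
  forall x z, lspan S x -> lspan T z -> E (star x * y * z) = 0.
Proof.
move=> h x z hx hz; rewrite -mulrA; apply: lspan_cexp0_star hx => x' Sx'.
rewrite mulrA -[_ * z]mulr1; apply: lspan_cexp0 hz => z' Tz'.
by rewrite mulr1; exact: h.
Qed.

End Span.

Section Words.
Variables (R : realType) (B A : cstarAlgType R) (C : set B).
Variables (theta EC Et : B -> B) (iota : B -> A) (EB : A -> A) (u : A).
Hypotheses (hC : unital_cstar_subalgebra C)
  (htheta : unital_star_embedding C theta)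
  (hEC : cond_exp C EC) (hECnd : nondegenerate_cexp EC)
  (hEt : cond_exp (theta @` C) Et)
  (hA : reduced_HNN C EC theta Et iota EB u).
Implicit Types (i j k n m N : nat) (b c d : B) (x y z w v : A) (e f g h : bool).

Let C1 : C 1. Proof. exact: csub_1 hC. Qed.

Let hi : unital_star_embedding setT iota. Proof. exact: hnn_iota hA. Qed.

Lemma iota1 : iota 1 = 1. Proof. exact: semb_1 hi. Qed.

Lemma iotaM b c : iota (b * c) = iota b * iota c.
Proof. exact: (semb_mul hi). Qed.

Lemma iota_star b : iota (star b) = star (iota b).
Proof. exact: (semb_star hi). Qed.

Lemma iotaD b c : iota (b + c) = iota b + iota c.
Proof. by have := semb_lin hi 1 (x := b) (y := c) I I; rewrite !scale1r. Qed.

Lemma iota0 : iota 0 = 0.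
Proof. by apply: (addIr (iota 0)); rewrite -iotaD !add0r. Qed.

Lemma iotaZ (r : R[i]) b : iota (r *: b) = r *: iota b.
Proof. by have := semb_lin hi r (x := b) (y := 0) I I; rewrite iota0 !addr0. Qed.

Lemma iotaN b : iota (- b) = - iota b.
Proof. by have := iotaZ (-1) b; rewrite !scaleN1r. Qed.

Lemma iotaB b c : iota (b - c) = iota b - iota c.
Proof. by rewrite iotaD iotaN. Qed.

Lemma iota_rs r : iota (rs B r) = rs A r.
Proof. by rewrite /rs iotaZ iota1. Qed.

Lemma iota_inj : injective iota.
Proof. by move=> b c; exact: (semb_inj hi). Qed.

Lemma iota_cpos b : cpos b -> cpos (iota b).
Proof.
by move=> /cpos_sqrt[q [[qs _] <- _ _]]; rewrite iotaM; apply: cpos_sqr; rewrite -iota_star qs.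
Qed.

(** The negative part is taken inside B: there n b n = - z^2, and the image of n b n is positive, so
    z = 0. *)
Lemma cpos_iota b : cpos (iota b) -> cpos b.
Proof.
move=> bp; have bs : star b = b.
  by apply: iota_inj; rewrite iota_star; exact: cpos_star.
have [z [n [zs ns nbn zpos _]]] := negative_part bs.
apply: zpos; apply: star_sqr_eq0; rewrite zs; apply: iota_inj; rewrite iota0.
apply: cpos_anti; first by apply: iota_cpos; exact: cpos_sqr.
by rewrite -iotaN -nbn !iotaM -{1}ns iota_star; exact: cpos_conj.
Qed.

Lemma iota_accretive b : accretive b <-> accretive (iota b).
Proof.
by rewrite /accretive -iota_star -iotaD; split; [exact: iota_cpos | exact: cpos_iota].
Qed.

Lemma uK : u * star u = 1. Proof. by have [] := hnn_unitary hA. Qed.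

Lemma Ku : star u * u = 1. Proof. by have [] := hnn_unitary hA. Qed.

Lemma u_theta c : C c -> u * iota (theta c) = iota c * u.
Proof. by move=> Cc; rewrite -(hnn_A hA Cc) -!mulrA Ku mulr1. Qed.

Lemma ustar_iota c : C c -> star u * iota c = iota (theta c) * star u.
Proof.
by move=> Cc; rewrite -(hnn_A hA Cc) !mulrA Ku mul1r.
Qed.

Lemma ustar_iota_u c : C c -> star u * iota c * u = iota (theta c).
Proof. by move=> Cc; rewrite ustar_iota // -mulrA Ku mulr1. Qed.

Let D1 : (theta @` C) 1.
Proof. by exists 1 => //; exact: semb_1 htheta. Qed.

Lemma ker_EC b : EC (b - EC b) = 0.
Proof. by rewrite (cexpB hEC) (cexp_idem hEC) subrr. Qed.

Lemma ker_Et b : Et (b - Et b) = 0.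
Proof. by rewrite (cexpB hEt) (cexp_idem hEt) subrr. Qed.

(** The condition for b to stand between u^e and u^g in a reduced word. Used at an end of a word,
    [compat false e] says that the word stays reduced after multiplication by u* on the left, and
    [compat f true] by u on the right. *)
Definition compat e g b : Prop :=
  (e = true -> g = false -> Et b = 0) /\ (e = false -> g = true -> EC b = 0).

Lemma compat_same e b : compat e e b.
Proof. by split=> ->. Qed.

Lemma compat_star e g b : compat e g b -> compat (~~ g) (~~ e) (star b).
Proof.
case: e; case: g => -[h1 h2]; split=> // _ _.
- by rewrite (cexp_star D1 hEt) h1 ?star0.
- by rewrite (cexp_star C1 hEC) h2 ?star0.
Qed.

Lemma star_upow e : star (upow u e) = upow u (~~ e).
Proof. by case: e => //=; rewrite starK. Qed.

(** The number counts the letters from B, so there is one more power of u; the booleans are the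
    first and last exponents, all that concatenation needs to know. *)
Inductive rword : nat -> bool -> bool -> A -> Prop :=
  | rword1 e : rword 0 e e (upow u e)
  | rwordS n e g f b w : compat e g b -> rword n g f w ->
      rword n.+1 e f (upow u e * iota b * w).

Lemma rword_cat n m e f g h b w v : rword n e f w -> compat f g b ->
  rword m g h v -> rword (n + m).+1 e h (w * iota b * v).
Proof.
move=> hw; elim: hw b => {n e f w} [e|n e g' f c w hc hw IH] b hb hv.
  exact: (rwordS hb hv).
have -> : upow u e * iota c * w * iota b * v =
  upow u e * iota c * (w * iota b * v) by ncring.
by rewrite addSn; exact: (rwordS hc (IH _ hb hv)).
Qed.

Lemma rword_star n e f w : rword n e f w -> rword n (~~ f) (~~ e) (star w).
Proof.
elim=> {n e f w} [e|n e g f b w hb hw IH]; first by rewrite star_upow; constructor.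
rewrite !starM star_upow -iota_star mulrA -[n]addn0.
exact: (rword_cat IH (compat_star hb) (rword1 _)).
Qed.

Lemma rword_EB0 n e f w : rword n e f w -> EB w = 0.
Proof.
move=> hw; suff [s [rs_ ->]] : exists s, reduced_word EC Et e s /\ w = hnn_word iota u e s.
  exact: hnn_M hA _ _ rs_.
elim: hw => {n e f w} [e|n e g f b w [h1 h2] hw [s [hs ->]]].
  by exists [::]; split=> //; rewrite /hnn_word big_nil mulr1.
by exists ((b, g) :: s); split; rewrite // /hnn_word big_cons /= !mulrA.
Qed.

Lemma EB_bimod b b' x : EB (iota b * x * iota b') = iota b * EB x * iota b'.
Proof. by apply: (cexp_bimod (hnn_cexp hA)); eexists. Qed.

Lemma word_EB0 n e f w b b' : rword n e f w -> EB (iota b * w * iota b') = 0.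
Proof. by move=> hw; rewrite EB_bimod (rword_EB0 hw) mulr0 mul0r. Qed.

Lemma EB_iota b : EB (iota b) = iota b.
Proof. by apply: (cexp_id (hnn_cexp hA)); exists b. Qed.

(** [EB] read in B rather than in its copy inside A, so that [EC] and [Et] can be composed with
    it. *)
Definition eB x : B := s2val (cid2 (cexp_range (hnn_cexp hA) x)).

Lemma eBE x : iota (eB x) = EB x.
Proof. by rewrite /eB; case: cid2. Qed.

(** The conditions on the two outermost letters may depend on the exponent next to them. *)
Definition bword (P Q : bool -> B -> Prop) : set A :=
  [set x | exists n e f w b b',
    [/\ rword n e f w, P e b, Q f b' & x = iota b * w * iota b']].

Definition anyB e b := True.
Definition endC g e b := e = g /\ C b.

(* Relative to the edge with stabiliser C of the Bass-Serre tree, the words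
   split into C, those starting with u (outer) and the rest.  Elements of alpha
   and beta both start and end on the same side. *)
Definition words : set A := range iota `|` bword anyB anyB.
Definition inner : set A := range iota `|` bword (compat false) anyB.
Definition outer : set A := bword (endC true) anyB.
Definition alpha : set A :=
  iota @` Ker EC `|` bword (compat false) (fun f => compat f true).
Definition beta : set A := bword (endC true) (endC false).

Lemma EC_mulC b c : C c -> EC b = 0 -> EC (b * c) = 0.
Proof. by move=> Cc b0; rewrite (cexp_mr C1 hEC) // b0 mul0r. Qed.

Lemma EC_Cmul b c : C c -> EC b = 0 -> EC (c * b) = 0.
Proof. by move=> Cc b0; rewrite (cexp_ml C1 hEC) // b0 mulr0. Qed.

Lemma EC_star0 b : EC b = 0 -> EC (star b) = 0.
Proof. by move=> b0; rewrite (cexp_star C1 hEC) b0 star0. Qed.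

Lemma compat_mulC e b c : C c -> compat e true b -> compat e true (b * c).
Proof. by move=> Cc [_ h]; split=> // /h h' /h'; exact: EC_mulC. Qed.

Lemma compat_Cmul e b c : C c -> compat false e b -> compat false e (c * b).
Proof. by move=> Cc [_ h]; split=> // /h h' /h'; exact: EC_Cmul. Qed.

Lemma words_star x : words x -> words (star x).
Proof.
case=> [[b _ <-]|[n [e [f [w [b [b' [hw _ _ ->]]]]]]]].
  by left; exists (star b); rewrite ?iota_star.
right; exists n, (~~ f), (~~ e), (star w), (star b'), (star b).
by split=> //; [exact: rword_star | rewrite !starM !iota_star mulrA].
Qed.

(** Nothing cancels in x* y: y begins with c u, and if x* has u* next to the junction, the letter
    there lies in (ker E_C) C, hence in ker E_C. *)
Lemma orthogonal_inner_outer x y : lspan inner x -> lspan outer y ->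
  EB (star x * y) = 0.
Proof.
move=> hx hy; rewrite -[star x]mulr1.
apply: (lspan_orthogonal (hnn_cexp hA)) hx hy => {x y} x y.
move=> hx [n [e [f [v [c [b' [hv [ee Cc] _ ->]]]]]]]; subst e.
rewrite mulr1; case: hx => [[b _ <-]|[m [g [h [w [b [b'' [hw hb _ ->]]]]]]]].
  have -> : star (iota b) * (iota c * v * iota b') =
    iota (star b * c) * v * iota b' by rewrite iotaM iota_star; ncring.
  exact: word_EB0 hv.
have -> : star (iota b * w * iota b'') * (iota c * v * iota b') =
    iota (star b'') * (star w * iota (star b * c) * v) * iota b'.
  by rewrite iotaM !iota_star !starM; ncring.
apply: (word_EB0 _ _ (rword_cat (rword_star hw) _ hv)).
exact: compat_mulC (compat_star hb).
Qed.

(** Both junctions of x* y z are reduced and y contains a power of u, so [EB] kills the product. The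
    compression of y to the inner words is thus zero, which is what Powers' argument needs. *)
Lemma inner_beta_inner x y z : lspan inner x -> lspan beta y -> lspan inner z ->
  EB (star x * y * z) = 0.
Proof.
move=> hx hy hz; apply: (lspan_cexp0 (hnn_cexp hA)) hy => {y} y hy.
apply: (lspan_orthogonal (hnn_cexp hA)) hx hz => {x z} x z hx hz.
move: hy => [n [e [f [v [c [c' [hv [ee Cc] [fe Cc'] ->]]]]]]]; subst e f.
have [m [e [v' [b1 [hv' E1]]]]] : exists m e v' b1, rword m e false v' /\
    star x * iota c * v = iota b1 * v'.
  case: hx => [[b _ <-]|[m [g [h [w [b [b'' [hw hb _ ->]]]]]]]].
    by exists n, true, v, (star b * c); rewrite iotaM iota_star.
  exists (m + n).+1, (~~ h), (star w * iota (star b * c) * v), (star b''); split.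
    apply: (rword_cat (rword_star hw) _ hv).
    exact: compat_mulC (compat_star hb).
  by rewrite iotaM !iota_star !starM; ncring.
have -> : star x * (iota c * v * iota c') * z =
  (star x * iota c * v) * iota c' * z by ncring.
rewrite E1; case: hz => [[b _ <-]|[m' [g [h [w [b [b'' [hw hb _ ->]]]]]]]].
  have -> : iota b1 * v' * iota c' * iota b = iota b1 * v' * iota (c' * b).
    by rewrite iotaM; ncring.
  exact: word_EB0 hv'.
have -> : iota b1 * v' * iota c' * (iota b * w * iota b'') =
    iota b1 * (v' * iota (c' * b) * w) * iota b'' by rewrite iotaM; ncring.
exact: (word_EB0 _ _ (rword_cat hv' (compat_Cmul Cc' hb) hw)).
Qed.

Lemma lspan_words_split x : lspan words x ->
  exists y z, [/\ lspan inner y, lspan outer z & x = y + z].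
Proof.
elim=> [{}x|| {}x y _ [d [e [hd he ->]]] _ [d' [e' [hd' he' ->]]]
       |k {}x _ [d [e [hd he ->]]]].
- case=> [[b _ <-]|[n [[] [f [w [b [b' [hw _ _ ->]]]]]]]].
  + exists (iota b), 0; rewrite addr0; split=> //; last exact: lspan0.
    by apply: lspan_in; left; exists b.
  + exists (iota (b - EC b) * w * iota b'), (iota (EC b) * w * iota b'); split.
    * apply: lspan_in; right; exists n, true, f, w, (b - EC b), b'.
      by split=> //; split=> // _ _; exact: ker_EC.
    * apply: lspan_in; exists n, true, f, w, (EC b), b'.
      by split=> //; split=> //; exact: cexp_range hEC _.
    * by rewrite iotaB; ncring.
  + exists (iota b * w * iota b'), 0; rewrite addr0; split=> //; last exact: lspan0.
    apply: lspan_in; right; exists n, false, f, w, b, b'.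
    by split=> //; exact: compat_same.
- by exists 0, 0; rewrite addr0; split=> //; exact: lspan0.
- exists (d + d'), (e + e'); rewrite addrACA.
  by split=> //; exact: lspanD.
- exists (k *: d), (k *: e); rewrite scalerDr.
  by split=> //; exact: lspanZ.
Qed.

(** * The words span a dense star-subalgebra *)

Lemma words_iota b : words (iota b).
Proof. by left; exists b. Qed.

Lemma words_bword n e f w b b' : rword n e f w -> words (iota b * w * iota b').
Proof. by move=> hw; right; exists n, e, f, w, b, b'. Qed.

Lemma rword_inv n e f w : rword n e f w ->
  (w = upow u e /\ e = f) \/
  exists m g b w', [/\ n = m.+1, compat e g b, rword m g f w' & w = upow u e * iota b * w'].
Proof.
case=> {n e f w} [e|n e g f b w hb hw]; first by left.
by right; exists n, g, b, w.
Qed.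

Lemma upowK e : upow u e * upow u (~~ e) = 1.
Proof. by case: e => /=; rewrite ?uK ?Ku. Qed.

Lemma lspan_words_mull_iota b x : lspan words x -> lspan words (iota b * x).
Proof.
rewrite -[_ * x]mulr1; apply: lspan_mul => {}x.
rewrite mulr1; case=> [[b' _ <-]|[n [e [f [w [c [c' [hw _ _ ->]]]]]]]].
  by rewrite -iotaM; exact/lspan_in/words_iota.
by rewrite !mulrA -iotaM; exact/lspan_in/(words_bword _ _ hw).
Qed.

Lemma lspan_words_upow e b b' n f w : rword n (~~ e) f w ->
  upow u e * iota b = iota b' * upow u e ->
  forall c, lspan words (upow u e * (iota b * w * iota c)).
Proof.
move=> hw eb c; have -> : upow u e * (iota b * w * iota c) =
  iota b' * (upow u e * w) * iota c by rewrite !mulrA eb.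
case: (rword_inv hw) => [[-> _]|[m [g [b1 [w' [_ _ hw' ->]]]]]].
  by rewrite upowK mulr1 -iotaM; exact/lspan_in/words_iota.
rewrite !mulrA -(mulrA _ (upow u e)) upowK mulr1 -iotaM.
exact/lspan_in/(words_bword _ _ hw').
Qed.

(** At a junction u^e b u^-e, write b as a kernel part plus its expectation: the first leaves a
    reduced word, the second moves across u^e, which then cancels. *)
Lemma lspan_words_mull_upow e x : lspan words x -> lspan words (upow u e * x).
Proof.
rewrite -[_ * x]mulr1; apply: lspan_mul => {}x.
rewrite mulr1; case=> [[b' _ <-]|[n [g [f [w [b [c [hw _ _ ->]]]]]]]].
  rewrite -[upow u e]mul1r -iota1.
  exact/lspan_in/(words_bword _ _ (rword1 e)).
have cons b1 : compat e g b1 -> lspan words (upow u e * (iota b1 * w * iota c)).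
  move=> hb1; have -> : upow u e * (iota b1 * w * iota c) =
    iota 1 * (upow u e * iota b1 * w) * iota c by rewrite iota1; ncring.
  exact/lspan_in/(words_bword _ _ (rwordS hb1 hw)).
have split_ d : (iota b * w * iota c) =
  iota (b - d) * w * iota c + iota d * w * iota c by rewrite iotaB; ncring.
case: e cons hw => cons; case: g cons => cons hw.
- exact/cons/compat_same.
- rewrite (split_ (Et b)) mulrDr; apply: lspanD.
    by apply: cons; split=> // _ _; exact: ker_Et.
  have [c' Cc' <-] := cexp_range hEt b.
  by apply: (@lspan_words_upow true _ c' _ _ _ hw); exact: u_theta.
- rewrite (split_ (EC b)) mulrDr; apply: lspanD.
    by apply: cons; split=> // _ _; exact: ker_EC.
  apply: (@lspan_words_upow false _ (theta (EC b)) _ _ _ hw).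
  by apply: ustar_iota; exact: cexp_range hEC _.
- exact/cons/compat_same.
Qed.

Lemma lspan_words_mul x y : lspan words x -> lspan words y -> lspan words (x * y).
Proof.
move=> hx hy; rewrite -[x]mul1r; apply: lspan_mul hx => {}x; rewrite mul1r.
case=> [[b' _ <-]|[n [g [f [w [b [c [hw _ _ ->]]]]]]]].
  exact: lspan_words_mull_iota.
rewrite -mulrA -mulrA; apply: lspan_words_mull_iota.
have : lspan words (iota c * y) by exact: lspan_words_mull_iota.
move: (iota c * y) => {hy}z; elim: hw z => {n g f w b c} [e|n e g f b w _ _ IH] z hz.
  exact: lspan_words_mull_upow.
rewrite -!mulrA; apply/lspan_words_mull_upow/lspan_words_mull_iota; exact: IH.
Qed.

Lemma lspan_words_star x : lspan words x -> lspan words (star x).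
Proof. by apply: lspan_star => {}x /words_star; exact: lspan_in. Qed.

Lemma lspan_words_u : lspan words u.
Proof.
rewrite -[u]mulr1 -iota1; apply: (lspan_words_mull_upow true).
exact/lspan_in/words_iota.
Qed.

Lemma lspan_words_dense x (e : R) : 0 < e -> exists2 y, lspan words y & cnorm (x - y) < e.
Proof.
move: e; apply/closure_cnorm.
suff -> : closure (lspan words) = setT by [].
apply: (hnn_gen hA); last first.
  move=> y [[b _ <-]|->]; apply: subset_closure; last exact: lspan_words_u.
  exact/lspan_in/words_iota.
split.
- by apply: subset_closure; rewrite -iota1; exact/lspan_in/words_iota.
- move=> k y z /closure_cnorm hy /closure_cnorm hz; apply/closure_cnorm => e e0.
  have K0 : 0 <= complex.Re `|k|.
    by have := cnormZ k (1 : A); rewrite cnorm1 mulr1 => <-; exact: cnorm_ge0.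
  have [y' Sy' hy'] := hy (e / 2 / (complex.Re `|k| + 1)) ltac:(by rewrite !divr_gt0 // ltr_wpDl).
  have [z' Sz' hz'] := hz (e / 2) ltac:(by rewrite divr_gt0).
  exists (k *: y' + z'); first by apply: lspanD => //; exact: lspanZ.
  have -> : k *: y + z - (k *: y' + z') = k *: (y - y') + (z - z').
    by rewrite scalerBr opprD addrACA.
  apply: le_lt_trans (cnormD _ _) _; rewrite cnormZ [e]splitr.
  apply: ler_ltD => //; move: hy'; rewrite ltr_pdivlMr ?ltr_wpDl // => hy'.
  by have := cnorm_ge0 (y - y'); nra.
- move=> y z /closure_cnorm hy /closure_cnorm hz; apply/closure_cnorm => e e0.
  have pos v : 0 < cnorm v + 1 by rewrite ltr_wpDl ?cnorm_ge0.
  have e2 : 0 < e / 2 by rewrite divr_gt0.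
  have [z' Sz'] := hz (e / 2 / (cnorm y + 1)) ltac:(by rewrite divr_gt0).
  rewrite ltr_pdivlMr // => hz'.
  have [y' Sy'] := hy (e / 2 / (cnorm z' + 1)) ltac:(by rewrite divr_gt0).
  rewrite ltr_pdivlMr // => hy'.
  exists (y' * z'); first exact: lspan_words_mul.
  have -> : y * z - y' * z' = y * (z - z') + (y - y') * z' by ncring.
  apply: le_lt_trans (cnormD _ _) _; rewrite [e]splitr.
  have := cnormM y (z - z'); have := cnormM (y - y') z'.
  have := cnorm_ge0 (y - y'); have := cnorm_ge0 (z - z'); nra.
- move=> y /closure_cnorm hy; apply/closure_cnorm => e /hy[y' Sy' hy'].
  by exists (star y'); [exact: lspan_words_star | rewrite -starB cnorm_star].
- exact: closed_closure.
Qed.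

(** * Powers' averaging *)

Let EB1 : (range iota) 1. Proof. by exists 1; rewrite ?iota1. Qed.

Let hEB : cond_exp (range iota) EB. Proof. exact: hnn_cexp hA. Qed.

Lemma EB_cpos_star_mul x : cpos (EB (star x * x)).
Proof. exact/(cexp_cpos hEB)/cpos_star_mul. Qed.

Lemma nondegenerate_dense x :
  (forall v, lspan words v -> accretive (EB (star v * x * v))) -> accretive x.
Proof.
move=> h; apply: (nondegenerate_accretive EB1 hEB (hnn_nondeg hA)) => v.
apply: accretive_lim => r r0.
(* K bounds |x| (|v| + |w|) for |v - w| < 1, hence the variation of v* x v between v and w is at
   most K |v - w|. *)
pose K := cnorm x * (2 * cnorm v + 1) + 1.
have K0 : 0 < K.
  by rewrite ltr_wpDl // mulr_ge0 ?cnorm_ge0 // addr_ge0 // mulr_ge0 ?cnorm_ge0.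
have [w hw vw] := @lspan_words_dense v (Num.min 1 (r / K)) ltac:(by rewrite lt_min ltr01 divr_gt0).
have -> : EB (star v * x * v) + rs A r = EB (star w * x * w) +
    (rs A r + EB (star v * x * v - star w * x * w)).
  by rewrite (cexpB hEB); ncring.
apply: accretiveD; first exact: h.
apply: accretive_bound; apply: le_trans (cexp_contr hEB _) _.
have -> : star v * x * v - star w * x * w =
    star (v - w) * x * v + star w * x * (v - w) by rewrite starB; ncring.
move: vw; rewrite lt_min => /andP[vw1]; rewrite ltr_pdivlMr // => vw2.
have wv : cnorm w <= cnorm v + 1.
  by have := cnormB v (v - w); rewrite subKr; lra.
apply: le_trans (cnormD _ _) _.
have h1 : cnorm (star (v - w) * x * v) <= cnorm (v - w) * cnorm x * cnorm v.
  apply: le_trans (cnormM _ _) _; apply: ler_wpM2r; first exact: cnorm_ge0.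
  by apply: le_trans (cnormM _ _) _; rewrite cnorm_star.
have h2 : cnorm (star w * x * (v - w)) <= cnorm w * cnorm x * cnorm (v - w).
  apply: le_trans (cnormM _ _) _; apply: ler_wpM2r; first exact: cnorm_ge0.
  by apply: le_trans (cnormM _ _) _; rewrite cnorm_star.
have h3 : cnorm w * cnorm x * cnorm (v - w) <= (cnorm v + 1) * cnorm x * cnorm (v - w).
  by apply: ler_wpM2r; rewrite ?cnorm_ge0 // ler_wpM2r // cnorm_ge0.
move: vw2 h1 h2 h3; rewrite /K; have := cnorm_ge0 (v - w).
move: (cnorm (v - w)) (cnorm x) (cnorm v) (cnorm w) => p q s t; nra.
Qed.

Variable a : B.
Hypotheses (hau : unitary a) (haC : commutant C a) (ha0 : EC a = 0).

Definition shift j : A := u ^+ j * iota a.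

Lemma u_expK j : star (u ^+ j) * u ^+ j = 1.
Proof.
elim: j => [|j IH]; first by rewrite star1 mul1r.
by rewrite exprS starM mulrA -(mulrA _ (star u)) Ku mulr1.
Qed.

Lemma u_Kexp j : u ^+ j * star (u ^+ j) = 1.
Proof.
elim: j => [|j IH]; first by rewrite star1 mul1r.
by rewrite exprSr starM mulrA -(mulrA _ u) uK mulr1.
Qed.

Lemma shiftK j : star (shift j) * shift j = 1.
Proof.
rewrite /shift starM mulrA -(mulrA _ (star (u ^+ j))) u_expK mulr1.
by rewrite -iota_star -iotaM; have [-> _] := hau; exact: iota1.
Qed.

Lemma Kshift j : shift j * star (shift j) = 1.
Proof.
rewrite /shift starM mulrA -(mulrA (u ^+ j)) -iota_star -iotaM.
by have [_ ->] := hau; rewrite iota1 mulr1 u_Kexp.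
Qed.

Lemma upow_rword m : rword m true true (u ^+ m.+1).
Proof.
elim: m => [|m IH]; first by rewrite expr1; exact: (rword1 true).
by rewrite exprS -[X in X * _]mulr1 -iota1; exact: (rwordS (compat_same _ _) IH).
Qed.

Lemma aC c : C c -> a * c = c * a.
Proof. exact: haC. Qed.

(** The product is x* a* u^(k-j) a y. On the left the junction is u* c a* u with c a* in ker E_C; on
    the right both exponents are +1. So the word is reduced. *)
Lemma shift_orthogonal_lt j k x y : (j < k)%N -> lspan outer x -> lspan outer y ->
  EB (star (shift j * x) * (shift k * y)) = 0.
Proof.
move=> jk hx hy.
have -> : star (shift j * x) * (shift k * y) =
    star x * (star (iota a) * u ^+ (k - j) * iota a) * y.
  rewrite /shift !starM.
  have -> : u ^+ k = u ^+ j * u ^+ (k - j) by rewrite -exprD subnKC // ltnW.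
  have -> : star x * (star (iota a) * star (u ^+ j)) *
    (u ^+ j * u ^+ (k - j) * iota a * y) = star x * star (iota a) *
    (star (u ^+ j) * u ^+ j) * u ^+ (k - j) * iota a * y by ncring.
  by rewrite u_expK; ncring.
apply: (lspan_orthogonal hEB) hx hy => {x y} x y.
move=> [n [e [f [v [c [b [hv [ee Cc] _ ->]]]]]]]; subst e.
move=> [m [e [g [w [c' [b' [hw [ee Cc'] _ ->]]]]]]]; subst e.
have [i ->] : exists i, (k - j)%N = i.+1 by exists (k - j).-1; rewrite prednK // subn_gt0.
have -> : star (iota c * v * iota b) * (star (iota a) * u ^+ i.+1 * iota a) *
    (iota c' * w * iota b') =
    iota (star b) * (star v * iota (star c * star a) * (u ^+ i.+1 * iota (a * c') * w))
      * iota b'.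
  by rewrite !iotaM !starM !iota_star; ncring.
apply: (word_EB0 _ _ (rword_cat (rword_star hv) _
  (rword_cat (upow_rword i) (compat_same _ _) hw))).
split=> // _ _; apply: EC_Cmul; first exact: csub_star hC _ Cc.
exact: EC_star0.
Qed.

Lemma shift_orthogonal j k x y : j != k -> lspan outer x -> lspan outer y ->
  EB (star (shift j * x) * (shift k * y)) = 0.
Proof.
rewrite neq_ltn => /orP[jk|kj] hx hy; first exact: shift_orthogonal_lt.
rewrite -[LHS]starK -(cexp_star EB1 hEB) starM starK.
by rewrite shift_orthogonal_lt ?star0.
Qed.

(** Bessel's inequality for the B-valued inner product E_B(x* y) and the orthogonal family
    [shift j * z j]; the hypothesis says that x minus each member is orthogonal to that member. *)
Lemma bessel (z : nat -> A) x N : (forall j, lspan outer (z j)) ->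
  (forall j, EB (star x * (shift j * z j)) = EB (star (z j) * z j)) ->
  cpos (EB (star x * x) - \sum_(j < N) EB (star (z j) * z j)).
Proof.
move=> hz hxz; pose y n := x - \sum_(j < n) shift j * z j.
suff <- : EB (star (y N) * y N) =
  EB (star x * x) - \sum_(j < N) EB (star (z j) * z j) by exact: EB_cpos_star_mul.
elim: N => [|N IH]; first by rewrite /y !big_ord0 !subr0.
pose t := shift N * z N.
have yt : EB (star (y N) * t) = EB (star (z N) * z N).
  rewrite starB mulrBl (cexpB hEB) hxz.
  suff h n : (n <= N)%N -> EB (star (\sum_(j < n) shift j * z j) * t) = 0.
    by rewrite h ?subr0.
  elim: n => [|n IHn] nN; first by rewrite big_ord0 star0 mul0r (cexp0 hEB).
  rewrite big_ord_recr /= starD mulrDl (cexpD hEB) IHn ?(ltnW nN) // add0r.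
  by apply: shift_orthogonal => //; rewrite neq_ltn nN.
have ty : EB (star t * y N) = EB (star (z N) * z N).
  rewrite -[LHS]starK -(cexp_star EB1 hEB) starM starK yt.
  by rewrite -(cexp_star EB1 hEB) star_sqr.
have tt : EB (star t * t) = EB (star (z N) * z N).
  rewrite /t starM; congr (EB _).
  by rewrite mulrA -(mulrA (star (z N))) shiftK mulr1.
have -> : y N.+1 = y N - t by rewrite /y big_ord_recr /= opprD addrA.
have -> : star (y N - t) * (y N - t) =
  star (y N) * y N - star (y N) * t - star t * y N + star t * t.
  by rewrite starB; ncring.
by rewrite (cexpD hEB) !(cexpB hEB) IH yt ty tt big_ord_recr /= subrK opprD addrA.
Qed.

(** A weighted Cauchy-Schwarz inequality: positivity of M + x at d y + z, divided by d, controls the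
    cross terms. A small d makes the y term cheap; the z term becomes expensive, but [bessel] bounds
    the sum of these over all translates. *)
Lemma quadratic_estimate (d M : R) x y z : 0 < d -> d <= 1 -> 0 <= M ->
  star x = x -> cnorm x <= M ->
  EB (star y * x * y) = 0 -> EB (star y * z) = 0 ->
  cpos (EB (star (y + z) * x * (y + z)) + rs A (d * M) * EB (star y * y)
    + rs A (2 * (d^-1 * M)) * EB (star z * z)).
Proof.
move=> d0 d1 M0 xs xM yxy yz.
have zy : EB (star z * y) = 0.
  by rewrite -[LHS]starK -(cexp_star EB1 hEB) starM starK yz star0.
have di0 : 0 <= d^-1 - 1 by rewrite subr_ge0 invf_ge1.
have Mx : cpos (rs A M + x) by exact: cpos_addr.
have h1 := cexp_cpos hEB (cpos_conj (rs A d * y + z) Mx).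
have h2 : cpos (EB (star z * (rs A M - x) * z)).
  by apply/(cexp_cpos hEB)/cpos_conj; exact: cpos_subr.
have h3 := EB_cpos_star_mul z.
have e1 : EB (star (rs A d * y + z) * (rs A M + x) * (rs A d * y + z)) =
    rs A d * (rs A (d * M) * EB (star y * y) + EB (star y * x * z)
      + EB (star z * x * y)) + rs A M * EB (star z * z) + EB (star z * x * z).
  have q1 v : star (rs A d * y + z) * v * (rs A d * y + z) =
      rs A d * (rs A d * (star y * v * y) + (star y * v * z + star z * v * y))
      + star z * v * z.
    have e w : w * (rs A d * y + z) = rs A d * (w * y) + w * z.
      by rewrite mulrDr rsCA.
    by rewrite starD star_rsM e; ncring.
  have q2 v w : star v * (rs A M + x) * w = rs A M * (star v * w) + star v * x * w.
    by rewrite mulrDr mulrDl rsC -!mulrA.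
  rewrite q1 !q2 !(cexpD hEB, cexp_rsM hEB) yxy yz zy rsM.
  by ncring.
have e2 : EB (star z * (rs A M - x) * z) = rs A M * EB (star z * z) - EB (star z * x * z).
  by rewrite mulrBr mulrBl rsC -(mulrA (rs A M)) (cexpB hEB) (cexp_rsM hEB).
have e3 : EB (star (y + z) * x * (y + z)) =
    EB (star y * x * z) + EB (star z * x * y) + EB (star z * x * z).
  have -> : star (y + z) * x * (y + z) = star y * x * y + star y * x * z
    + star z * x * y + star z * x * z by rewrite starD; ncring.
  by rewrite !(cexpD hEB) yxy add0r.
rewrite e1 in h1; rewrite e2 in h2; rewrite e3.
move: h1 h2 h3; set p := EB (star y * y); set q := EB (star y * x * z).
set r := EB (star z * x * y); set s := EB (star z * z); set t := EB (star z * x * z).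
move=> h1 h2 h3.
have -> : q + r + t + rs A (d * M) * p + rs A (2 * (d^-1 * M)) * s =
  rs A d^-1 * (rs A d * (rs A (d * M) * p + q + r) + rs A M * s + t)
  + rs A (d^-1 - 1) * (rs A M * s - t) + rs A M * s.
  have -> : 2 * (d^-1 * M) = d^-1 * M + d^-1 * M by ring.
  rewrite !(mulrDr (rs A d^-1)) (mulrA (rs A d^-1) (rs A d)) -rsM mulVf ?gt_eqF //.
  by rewrite !rsB !rsD !rsM rs1; ncring.
apply: cposD; last exact: cpos_rsM.
apply: cposD; last exact: cpos_rsM.
by apply: cpos_rsM => //; rewrite invr_ge0 ltW.
Qed.

Definition average N x : A :=
  rs A N%:R^-1 * \sum_(j < N) shift j * x * star (shift j).

Lemma averageD N x y : average N (x + y) = average N x + average N y.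
Proof.
rewrite /average -mulrDr -big_split; congr (_ * _); apply: eq_bigr => j _.
by rewrite mulrDr mulrDl.
Qed.

Lemma averageN N x : average N (- x) = - average N x.
Proof.
rewrite /average -mulrN -sumrN; congr (_ * _); apply: eq_bigr => j _.
by rewrite mulrN mulNr.
Qed.

Lemma average_rs N r : (0 < N)%N -> average N (rs A r) = rs A r.
Proof.
move=> N0; rewrite /average.
under eq_bigr => j _ do rewrite rsC -mulrA Kshift mulr1.
have -> : \sum_(j < N) rs A r = rs A N%:R * rs A r.
  elim: (N) => [|n IH]; first by rewrite big_ord0 rs0 mul0r.
  by rewrite big_ord_recr /= IH -natr1 rsD rs1 mulrDl mul1r.
by rewrite mulrA -rsM mulVf ?rs1 ?mul1r // pnatr_eq0 -lt0n.
Qed.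

Lemma accretive_average N x : accretive x -> accretive (average N x).
Proof.
move=> hx; apply: accretive_rsM; first by rewrite invr_ge0.
apply: accretive_sum => j; rewrite -{1}[shift j]starK; exact: accretive_conj.
Qed.

Lemma ideal_average (J : set A) N x : closed_ideal setT J -> J x -> J (average N x).
Proof.
move=> hJ Jx; apply: (ideal_mull hJ) => //.
elim/big_rec: _ => [|j y _ Jy]; first exact: ideal_0 hJ.
rewrite -[_ * star _]scale1r; apply: (ideal_lin hJ) => //.
by apply: (ideal_mulr hJ) => //; apply: (ideal_mull hJ).
Qed.

(* Powers' averaging: an element of beta maps inner words to outer ones, and the
   translates of the outer words by the elements u^j a are mutually orthogonal. *)
Lemma average_beta y (r : R) : lspan beta y -> 0 < r ->
  exists2 N, (0 < N)%N & accretive (average N y + rs A r).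
Proof.
move=> hy r0; pose T := y + star y; pose M := cnorm T + 1.
have M0 : 0 < M by rewrite ltr_wpDl ?cnorm_ge0.
have TM : cnorm T <= M by rewrite lerDl.
have Ts : star T = T by rewrite starD starK addrC.
(* Each inner part costs at most d M <= r. The outer parts cost K in total by Bessel, hence K / N <=
   r on average. Together they fit in the 2 r that the real part of [average N y + rs A r]
   offers. *)
pose d := Num.min 1 (r / M).
have d0 : 0 < d by rewrite lt_min ltr01 divr_gt0.
have d1 : d <= 1 by rewrite ge_min lexx.
have dM : d * M <= r by rewrite -ler_pdivlMr // ge_min lexx orbT.
pose K := 2 * (d^-1 * M).
have K0 : 0 <= K by rewrite !mulr_ge0 // ?invr_ge0 ltW.
pose N := Num.bound (K / r).
have KN : K / r < N%:R by apply: archi_boundP; rewrite divr_ge0 // ltW.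
have N0' : 0 < N%:R :> R by apply: le_lt_trans KN; rewrite divr_ge0 // ltW.
have N0 : (0 < N)%N by rewrite ltr0n in N0'.
exists N => //; apply: nondegenerate_dense => x hx.
pose h j := star (shift j) * x.
have hs j : star (h j) = star x * shift j by rewrite (starM (star (shift j))) starK.
have /choice[f hf] j : exists p : A * A,
    [/\ lspan inner p.1, lspan outer p.2 & h j = p.1 + p.2].
  have hj : lspan words (h j).
    apply: lspan_words_mul hx; apply: lspan_words_star; apply: lspan_words_mul.
      elim: j => [|j IH]; first by rewrite expr0 -iota1; exact/lspan_in/words_iota.
      by rewrite exprS; apply: lspan_words_mul => //; exact: lspan_words_u.
    exact/lspan_in/words_iota.
  by have [p [q [hp hq e]]] := lspan_words_split hj; exists (p, q).
pose p j := (f j).1; pose q j := (f j).2.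
have hp j : lspan inner (p j) by have [] := hf j.
have hq j : lspan outer (q j) by have [] := hf j.
have hpq j : h j = p j + q j by have [] := hf j.
pose X := EB (star x * x).
pose P j := EB (star (p j) * p j); pose Q j := EB (star (q j) * q j).
have pq j : EB (star (p j) * q j) = 0 by exact: orthogonal_inner_outer.
have qp j : EB (star (q j) * p j) = 0.
  by rewrite -[LHS]starK -(cexp_star EB1 hEB) starM starK pq star0.
have PQ j : P j = X - Q j.
  have -> : X = EB (star (h j) * h j).
    by rewrite /h starM starK mulrA -(mulrA (star x)) Kshift mulr1.
  rewrite hpq starD mulrDl !mulrDr !(cexpD hEB) pq qp addr0 add0r.
  by rewrite /P /Q addrK.
have hQ : cpos (X - \sum_(j < N) Q j).
  apply: (@bessel q x N) => // j.
  have -> : star x * (shift j * q j) = star (h j) * q j.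
    by rewrite /h starM starK mulrA.
  by rewrite hpq starD mulrDl (cexpD hEB) pq add0r.
have pTp j : EB (star (p j) * T * p j) = 0.
  rewrite /T mulrDr mulrDl (cexpD hEB) inner_beta_inner // add0r.
  have -> : star (p j) * star y * p j = star (star (p j) * y * p j).
    by rewrite !starM starK mulrA.
  by rewrite (cexp_star EB1 hEB) inner_beta_inner // star0.
pose Z j := EB (star (h j) * T * h j).
have hZ : cpos (\sum_(j < N) (Z j + rs A (d * M) * P j + rs A K * Q j)).
  apply: cpos_sum => j; rewrite /Z hpq.
  by apply: quadratic_estimate => //; exact: ltW.
have E1 : EB (star x * (average N y + rs A r) * x)
    + star (EB (star x * (average N y + rs A r) * x)) =
    rs A N%:R^-1 * \sum_(j < N) Z j + rs A (r + r) * X.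
  have -> : star x * (average N y + rs A r) * x =
      rs A N%:R^-1 * (\sum_(j < N) star (h j) * y * h j) + rs A r * (star x * x).
    rewrite mulrDr mulrDl rsC -(mulrA (rs A r)); congr (_ + _).
    rewrite /average rsCA -mulrA; congr (_ * _).
    rewrite mulr_sumr mulr_suml; apply: eq_bigr => j _.
    by rewrite hs /h !mulrA.
  rewrite -(cexp_star EB1 hEB) -(cexpD hEB) starD !star_rsM star_sqr addrACA.
  rewrite -mulrDr -mulrDl -rsD (cexpD hEB) !(cexp_rsM hEB); congr (_ * _ + _).
  rewrite (big_morph _ (@starD R A) (star0 A)) -big_split /=.
  rewrite (big_morph _ (cexpD hEB) (cexp0 hEB)); apply: eq_bigr => j _.
  by rewrite /Z /T; congr (EB _); move: (h j) => v; rewrite !starM starK; ncring.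
rewrite /accretive E1.
pose S := \sum_(j < N) Z j; pose Q0 := \sum_(j < N) Q j.
have E2 : \sum_(j < N) (Z j + rs A (d * M) * P j + rs A K * Q j) =
    S + rs A (d * M) * (rs A N%:R * X - Q0) + rs A K * Q0.
  rewrite !big_split /= -!mulr_sumr; congr (_ + _ * _ + _).
  under eq_bigr => j _ do rewrite PQ.
  rewrite sumrB; congr (_ - _).
  elim: (N) => [|n IH]; first by rewrite big_ord0 rs0 mul0r.
  by rewrite big_ord_recr /= IH -natr1 rsD rs1 mulrDl mul1r.
rewrite E2 in hZ.
have hQ0 : cpos Q0 by apply: cpos_sum => j; exact: EB_cpos_star_mul.
have hX : cpos X by exact: EB_cpos_star_mul.
have h1 : cpos (S + rs A (d * M * N%:R + K) * X).
  have -> : S + rs A (d * M * N%:R + K) * X =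
      (S + rs A (d * M) * (rs A N%:R * X - Q0) + rs A K * Q0)
      + rs A (d * M) * Q0 + rs A K * (X - Q0).
    by rewrite rsD (rsM _ (d * M)); ncring.
  apply: cposD; last exact: cpos_rsM.
  by apply: cposD => //; apply: cpos_rsM => //; rewrite mulr_ge0 // ltW.
have -> : rs A N%:R^-1 * S + rs A (r + r) * X =
   rs A N%:R^-1 * (S + rs A (d * M * N%:R + K) * X)
   + rs A (r + r - N%:R^-1 * (d * M * N%:R + K)) * X.
  by rewrite rsB (rsM _ N%:R^-1); ncring.
apply: cposD; first by apply: cpos_rsM => //; rewrite invr_ge0.
apply: cpos_rsM => //; rewrite mulrDr mulrCA mulVf ?gt_eqF // mulr1.
have : N%:R^-1 * K <= r.
  by rewrite mulrC ler_pdivrMr // mulrC -ler_pdivrMr // ltW.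
move: dM; lra.
Qed.

(** Averaging fixes r, keeps x in J and makes y harmless up to r / 2. What remains is an element of
    J with real part at most -r / 2, so J would contain 1. *)
Lemma proper_ideal_beta (J : set A) x y (r : R) : closed_ideal setT J -> ~ J 1 ->
  J x -> lspan beta y -> 0 < r -> ~ accretive (- rs A r - x - y).
Proof.
move=> hJ J1 Jx hy r0 hxy; apply: J1.
have [N N0 hN] := average_beta hy (r := r / 2) ltac:(by rewrite divr_gt0).
apply: (@closed_ideal_accretive _ _ J (average N x) (r / 2)) => //.
- exact: ideal_average.
- by rewrite divr_gt0.
have -> : - average N x - rs A (r / 2) =
    average N (- rs A r - x - y) + (average N y + rs A (r / 2)).
  rewrite !averageD !averageN average_rs //.
  by rewrite {2}[r]splitr rsD; ncring.
by apply: accretiveD => //; exact: accretive_average.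
Qed.

(** * The cone of a proper ideal *)

Variable b : B.
Hypotheses (hbu : unitary b) (hbC : commutant (theta @` C) b) (hb0 : Et b = 0).

(** The counterpart of a across the base edge: as b commutes with theta(C), this unitary commutes
    with C. *)
Definition ubu : A := u * iota b * star u.

Lemma ubuC c : C c -> ubu * iota c = iota c * ubu.
Proof.
move=> Cc; rewrite /ubu -!mulrA ustar_iota // (mulrA (iota b)) -iotaM.
rewrite hbC; last by exists c.
by rewrite iotaM !mulrA u_theta.
Qed.

Lemma star_ubu : star ubu = u * iota (star b) * star u.
Proof. by rewrite /ubu !starM starK iota_star mulrA. Qed.

Lemma Kubu : ubu * star ubu = 1.
Proof.
have -> : ubu * star ubu = u * (iota b * (star u * u) * iota (star b)) * star u.
  by rewrite star_ubu /ubu; ncring.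
by rewrite Ku mulr1 -iotaM; have [_ ->] := hbu; rewrite iota1 mulr1 uK.
Qed.

Lemma ubu_conjC c : C c -> ubu * iota c * star ubu = iota c.
Proof. by move=> Cc; rewrite ubuC // -mulrA Kubu mulr1. Qed.

Lemma EtN0 (k : B) : Et k = 0 -> Et (star k) = 0.
Proof. by move=> k0; rewrite (cexp_star D1 hEt) k0 star0. Qed.

Lemma rword_ustar_alpha x : alpha x -> exists n, rword n false true (star u * x * u).
Proof.
case=> [[k k0 <-]|[n [e [f [w [c [c' [hw hc hc' ->]]]]]]]].
  by exists 1; apply: (@rwordS _ false true true _ u) (rword1 true).
exists (n.+1 + 0).+1.
have -> : star u * (iota c * w * iota c') * u =
  star u * iota c * w * iota c' * u by ncring.
exact: (rword_cat (rwordS hc hw) hc' (rword1 true)).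
Qed.

Lemma beta_rword n v : rword n true false v -> beta v.
Proof.
move=> hv; exists n, true, false, v, 1, 1.
by split; rewrite ?iota1 ?mulr1 ?mul1r //; split.
Qed.

Lemma beta_u_conj (k k' : B) x : Et k = 0 -> Et k' = 0 -> alpha x ->
  beta (u * iota k * star u * x * (u * iota k' * star u)).
Proof.
move=> k0 k0' /rword_ustar_alpha[n hn]; apply: (@beta_rword (n.+1 + 0).+1).
have -> : u * iota k * star u * x * (u * iota k' * star u) =
  u * iota k * (star u * x * u) * iota k' * star u by ncring.
by apply: (rword_cat (rwordS (e := true) _ hn) _ (rword1 false)); split.
Qed.

Lemma alpha_conj_beta (k k' : B) x : EC k = 0 -> EC k' = 0 -> beta x ->
  alpha (iota k * x * iota k').
Proof.
move=> k0 k0' [n [e [f [v [c [c' [hv [ee Cc] [fe Cc'] ->]]]]]]]; subst e f.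
right; exists n, true, false, v, (k * c), (c' * k').
split=> //; first by split=> // _ _; exact: EC_mulC.
- by split=> // _ _; exact: EC_Cmul.
- by rewrite !iotaM; ncring.
Qed.

Lemma beta_C c (c' : B) x : C c -> C c' -> beta x -> beta (iota c * x * iota c').
Proof.
move=> Cc Cc' [n [e [f [v [d [d' [hv [ee Cd] [fe Cd'] ->]]]]]]]; subst e f.
exists n, true, false, v, (c * d), (d' * c').
split=> //; first by split=> //; exact: (csub_mul hC Cc Cd).
- by split=> //; exact: (csub_mul hC Cd' Cc').
- by rewrite !iotaM; ncring.
Qed.

Section ProperIdeal.
Variable J : set A.
Hypotheses (hJ : closed_ideal setT J) (J1 : ~ J 1).

Lemma ideal_conj x v w : J x -> J (v * x * w).
Proof. by move=> Jx; apply: (ideal_mulr hJ) => //; exact: (ideal_mull hJ). Qed.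

Lemma idealD x y : J x -> J y -> J (x + y).
Proof. by move=> Jx; have := ideal_lin hJ 1 Jx (y := y); rewrite scale1r. Qed.

Lemma idealZ (k : R[i]) x : J x -> J (k *: x).
Proof. by move=> Jx; rewrite -[_ *: x]addr0; apply: (ideal_lin hJ) => //; exact: ideal_0 hJ. Qed.

(* The dual cone of the functionals on C that extend to states of A vanishing on
   J and on S. *)
Definition cone (S : set A) c : Prop := forall r : R, 0 < r ->
  exists x y, [/\ J x, lspan S y & accretive (iota c + rs A r - x - y)].

(** The difference between v* c v and d only has to lie in the span of T, where it is absorbed by y.
    The slack is taken as r / M because v* v <= M. *)
Lemma cone_conj (S T : set A) c d v : C d ->
  (forall y, S y -> lspan T (star v * y * v)) ->
  lspan T (star v * iota c * v - iota d) -> cone S c -> cone T d.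
Proof.
move=> Cd ST Td hc r r0; pose M := cnorm v ^+ 2 + 1.
have M0 : 0 < M by rewrite ltr_wpDl ?exprn_ge0 ?cnorm_ge0.
have [x [y [Jx Sy h]]] := hc (r / M) ltac:(by rewrite divr_gt0).
exists (star v * x * v), (star v * y * v - (star v * iota c * v - iota d)); split.
- exact: ideal_conj.
- by apply: lspanB => //; apply: lspan_mul Sy.
have := accretiveD (accretive_conj v h)
  (accretive_rsM (r := r / M) (ltW _) (accretive_bound_star (v := v) (M := M) _)).
have -> : star v * (iota c + rs A (r / M) - x - y) * v +
    rs A (r / M) * (rs A M - star v * v) =
    iota d + rs A r - star v * x * v -
    (star v * y * v - (star v * iota c * v - iota d)).
  have -> : rs A r = rs A (r / M) * rs A M by rewrite -rsM divfK ?gt_eqF.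
  have e : star v * rs A (r / M) = rs A (r / M) * star v by rewrite rsC.
  rewrite 2!mulrBr (mulrDr (star v)) e; ncring.
by apply; [rewrite divr_gt0 | rewrite lerDl].
Qed.

Lemma cone_le S c d : accretive (iota d - iota c) -> cone S c -> cone S d.
Proof.
move=> h hc r /hc[x [y [Jx Sy hxy]]]; exists x, y; split=> //.
have := accretiveD hxy h; congr (accretive _); ncring.
Qed.

Lemma coneD S c d : cone S c -> cone S d -> cone S (c + d).
Proof.
move=> hc hd r r0; have r2 : 0 < r / 2 by rewrite divr_gt0.
have [x [y [Jx Sy h]]] := hc _ r2; have [x' [y' [Jx' Sy' h']]] := hd _ r2.
exists (x + x'), (y + y'); split; [exact: idealD | exact: lspanD |].
have -> : rs A r = rs A (r / 2) + rs A (r / 2) by rewrite -rsD -splitr.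
by have := accretiveD h h'; rewrite iotaD; congr (accretive _); ncring.
Qed.

Lemma cone_lim S c : (forall r : R, 0 < r -> cone S (c + rs B r)) -> cone S c.
Proof.
move=> hc r r0; have r2 : 0 < r / 2 by rewrite divr_gt0.
have [x [y [Jx Sy h]]] := hc _ r2 _ r2; exists x, y; split=> //.
have -> : rs A r = rs A (r / 2) + rs A (r / 2) by rewrite -rsD -splitr.
by move: h; rewrite iotaD iota_rs; congr (accretive _); ncring.
Qed.

Lemma cone_rsM S c (r : R) : 0 <= r -> cone S c -> cone S (rs B r * c).
Proof.
move=> r0 hc q q0; have p0 : 0 < q / (r + 1) by rewrite divr_gt0 // ltr_wpDl.
have [x [y [Jx Sy h]]] := hc _ p0.
exists (rs A r * x), (rs A r * y); split.
- by rewrite rsE; exact: idealZ.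
- exact: lspan_rsM.
have hq : 0 <= q - r * (q / (r + 1)).
  rewrite subr_ge0 mulrCA ler_piMr ?(ltW q0) // ler_pdivrMr ?ltr_wpDl // mul1r.
  by rewrite lerDl.
have := accretiveD (accretive_rsM r0 h) (accretive_rs A hq).
congr (accretive _); rewrite iotaM iota_rs rsB (rsM _ r); ncring.
Qed.

Lemma cone_accretive S c : accretive c -> cone S c.
Proof.
move=> /iota_accretive hc r r0; exists 0, 0; split.
- exact: ideal_0 hJ.
- exact: lspan0.
- by rewrite !subr0; apply: accretiveD => //; apply: accretive_rs; exact: ltW.
Qed.

Lemma cone_beta_alpha c : C c -> cone beta c -> cone alpha c.
Proof.
move=> Cc; apply: (cone_conj (v := iota a)) => // [y hy|].
  by rewrite -iota_star; apply/lspan_in/alpha_conj_beta => //; exact: EC_star0.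
have -> : star (iota a) * iota c * iota a - iota c = 0.
  rewrite -iota_star -!iotaM -mulrA -aC // mulrA; have [-> _] := hau.
  by rewrite mul1r subrr.
exact: lspan0.
Qed.

Lemma cone_alpha_beta c : C c -> cone alpha c -> cone beta c.
Proof.
move=> Cc; apply: (cone_conj (v := star ubu)) => // [y hy|]; rewrite starK.
  by rewrite star_ubu; apply/lspan_in/beta_u_conj => //; exact: EtN0.
by rewrite ubu_conjC // subrr; exact: lspan0.
Qed.

Lemma cone_C c d : C c -> C d -> cone beta c -> cone beta (star d * c * d).
Proof.
move=> Cc Cd; have Cd' := csub_star hC Cd.
apply: (cone_conj (v := iota d)) => [|y hy|].
- by apply: (csub_mul hC) => //; exact: (csub_mul hC).
- by rewrite -iota_star; apply/lspan_in/beta_C.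
- by rewrite -iota_star -!iotaM subrr; exact: lspan0.
Qed.

(** Write d = E_C(d) + k; the cross terms vanish under E_C. Conjugation by k takes beta into alpha,
    and k* c k differs from its expectation by an element of ker E_C, which also belongs to alpha; u
    b u* then leads back to beta. *)
Lemma cone_EC c d : C c -> cone beta c -> cone beta (EC (star d * c * d)).
Proof.
move=> Cc hc; pose k := d - EC d; have k0 : EC k = 0 by exact: ker_EC.
have Ed : C (EC d) by exact: cexp_range hEC _.
have -> : EC (star d * c * d) = star (EC d) * c * EC d + EC (star k * c * k).
  have -> : star d * c * d = star (EC d) * c * EC d + star (EC d) * c * k
      + (star k * c * EC d + star k * c * k).
    by rewrite /k starB; ncring.
  have Cs : C (star (EC d) * c) by apply: (csub_mul hC) => //; exact: (csub_star hC).
  rewrite !(cexpD hEC) (cexp_ml C1 hEC _ Cs) (cexp_ml C1 hEC k Cs) k0 mulr0 addr0.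
  rewrite -(mulrA (star k)) (cexp_mr C1 hEC); last exact: (csub_mul hC).
  by rewrite (EC_star0 k0) mul0r add0r (cexp_idem hEC).
apply: coneD; first exact: cone_C.
have CE : C (EC (star k * c * k)) by exact: cexp_range hEC _.
apply: cone_alpha_beta => //; apply: (cone_conj (v := iota k)) hc => // [y hy|].
  by rewrite -iota_star; apply/lspan_in/alpha_conj_beta => //; exact: EC_star0.
rewrite -iota_star -!iotaM -iotaB; apply: lspan_in; left; eexists; last by [].
exact: ker_EC.
Qed.

Lemma theta_mul c d : C c -> C d -> theta (c * d) = theta c * theta d.
Proof. exact: (semb_mul htheta). Qed.

Lemma theta_star c : C c -> theta (star c) = star (theta c).
Proof. exact: (semb_star htheta). Qed.

(** The same on the other side of the edge, in the opposite order: a first takes beta to alpha, then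
    u k u* with k in ker E_theta takes alpha to beta. *)
Lemma cone_Et c (m : B) d : C c -> C m -> theta m = Et (star d * theta c * d) ->
  cone beta c -> cone beta m.
Proof.
move=> Cc Cm hm hc; have [e Ce ed] := cexp_range hEt d.
pose k := d - theta e; have k0 : Et k = 0 by rewrite /k ed; exact: ker_Et.
have [m' Cm' hm'] := cexp_range hEt (star k * theta c * k).
have Ce' : C (star e) by exact: (csub_star hC Ce).
have Cec : C (star e * c) by exact: (csub_mul hC Ce' Cc).
have Cece : C (star e * c * e) by exact: (csub_mul hC Cec Ce).
have -> : m = star e * c * e + m'.
  apply: (semb_inj htheta) => //; first exact: (csub_add hC Cece Cm').
  have := semb_lin htheta 1 Cece Cm'; rewrite !scale1r => ->.
  rewrite hm hm' !theta_mul // theta_star //.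
  have -> : star d * theta c * d = star (theta e) * theta c * theta e
      + star (theta e) * theta c * k
      + (star k * (theta c * theta e) + star k * theta c * k).
    by rewrite /k starB; ncring.
  have Ds : (theta @` C) (star (theta e) * theta c).
    by exists (star e * c) => //; rewrite theta_mul // theta_star.
  have Dc : (theta @` C) (theta c * theta e).
    by exists (c * e); rewrite ?theta_mul //; exact: (csub_mul hC Cc Ce).
  rewrite !(cexpD hEt) (cexp_ml D1 hEt _ Ds) (cexp_ml D1 hEt k Ds) k0 mulr0 addr0.
  rewrite (cexp_mr D1 hEt _ Dc) (EtN0 k0) mul0r add0r.
  by rewrite (cexp_id hEt (d := theta e)) //; exists e.
apply: coneD; first exact: cone_C.
clearbody k; apply: (cone_conj (v := u * iota k * star u)) (cone_beta_alpha Cc hc) => // [y hy|].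
  have -> : star (u * iota k * star u) = u * iota (star k) * star u.
    by rewrite !starM starK iota_star mulrA.
  by apply/lspan_in/beta_u_conj => //; exact: EtN0.
have -> : star (u * iota k * star u) * iota c * (u * iota k * star u) - iota m' =
    u * iota (star k * theta c * k - theta m') * star u.
  rewrite iotaB !iotaM -(ustar_iota_u Cc) -[iota m'](hnn_A hA) // !starM starK iota_star.
  ncring.
apply/lspan_in/(@beta_rword 1).
apply: (@rwordS _ true false false _ (star u)) (rword1 false); split=> // _ _.
by rewrite hm'; exact: ker_Et.
Qed.

(** * The ideal N of C and its invariance *)

Definition null_ideal : set B := [set c | C c /\ cone beta (- (star c * c))].

Lemma null_idealZ (k : R[i]) c : null_ideal c -> null_ideal (k *: c).
Proof.
move=> [Cc hc]; split; first exact: csub_scale hC _ _ Cc.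
pose r := complex.Re `|k|; have kk : Num.conj k * k = (r * r)%:C%C.
  by rewrite rmorphM /= /r RRe_real ?normr_real // -expr2 normCK mulrC.
have -> : - (star (k *: c) * (k *: c)) = rs B (r * r) * - (star c * c).
  by rewrite starZ -scalerAl -scalerAr scalerA kk mulrN rsE.
by apply: cone_rsM => //; rewrite -expr2 sqr_ge0.
Qed.

Lemma null_idealD c d : null_ideal c -> null_ideal d -> null_ideal (c + d).
Proof.
move=> [Cc hc] [Cd hd]; split; first exact: csub_add hC _ _ Cc Cd.
(* The parallelogram identity. *)
have -> : - (star (c + d) * (c + d)) = - (star c * c) + - (star c * c)
    + (- (star d * d) + - (star d * d)) + star (c - d) * (c - d).
  by rewrite starB starD; ncring.
apply: coneD; first by apply: coneD; apply: coneD.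
exact/cone_accretive/accretive_star_mul.
Qed.

Lemma null_ideal_mull c d : C d -> null_ideal c -> null_ideal (d * c).
Proof.
move=> Cd [Cc hc]; split; first exact: (csub_mul hC).
have h := cone_rsM (sqr_ge0 (cnorm d)) hc.
apply: cone_le h; rewrite -iotaB; apply/iota_accretive.
have -> : - (star (d * c) * (d * c)) - rs B (cnorm d ^+ 2) * - (star c * c) =
    star c * (rs B (cnorm d ^+ 2) - star d * d) * c.
  by rewrite starM mulrBr rsC; ncring.
by apply/accretive_conj/accretive_bound_star.
Qed.

Lemma null_ideal_mulr c d : C d -> null_ideal c -> null_ideal (c * d).
Proof.
move=> Cd [Cc hc]; split; first exact: (csub_mul hC).
have -> : - (star (c * d) * (c * d)) = star d * - (star c * c) * d.
  by rewrite starM; ncring.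
apply: cone_C => //; rewrite -[- _]add0r; apply: (csub_sub hC).
  exact: csub_0 hC.
by apply: (csub_mul hC) => //; exact: (csub_star hC).
Qed.

Lemma CN c : C c -> C (- c).
Proof. by move=> Cc; rewrite -[- c]add0r; apply: (csub_sub hC) => //; exact: csub_0 hC. Qed.

Lemma Cstar_mul c : C c -> C (star c * c).
Proof. by move=> Cc; apply: (csub_mul hC) => //; exact: (csub_star hC). Qed.

Lemma null_ideal_closed : closed null_ideal.
Proof.
apply/closed_cnorm => c hc.
have Cc : C c.
  apply: (proj1 (closed_cnorm C) (csub_closed hC)) => r /hc[d [Cd _] cd].
  by exists d.
split=> //; apply: cone_lim => r r0.
(* K bounds |c| + |d| once |c - d| < 1, so c* c and d* d differ by at most K |c - d|. *)
pose K := 2 * cnorm c + 1; have K0 : 0 < K by rewrite ltr_wpDl // mulr_ge0 ?cnorm_ge0.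
have [d [Cd hd]] := hc (Num.min 1 (r / K)) ltac:(by rewrite lt_min ltr01 divr_gt0).
rewrite lt_min ltr_pdivlMr // => /andP[cd1 cd].
apply: cone_le hd; rewrite -iotaB; apply/iota_accretive.
have -> : - (star c * c) + rs B r - - (star d * d) =
    rs B r + (star (d - c) * d + star c * (d - c)) by rewrite starB; ncring.
apply: accretive_bound; apply: le_trans (cnormD _ _) _.
have h1 := cnormM (star (d - c)) d; have h2 := cnormM (star c) (d - c).
rewrite !cnorm_star !(cnormBC d) in h1 h2.
have h3 : cnorm d <= cnorm c + 1 by have := cnormB c (c - d); rewrite subKr; lra.
move: h1 h2 h3 cd; rewrite /K.
have := cnorm_ge0 (c - d); nra.
Qed.

Lemma null_ideal_closed_ideal : closed_ideal C null_ideal.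
Proof.
split.
- by move=> c [].
- split; first exact: csub_0 hC.
  rewrite mulr0 oppr0; apply: cone_accretive.
  by rewrite -(rs0 B); exact: accretive_rs.
- by move=> k c d hc hd; apply: null_idealD => //; exact: null_idealZ.
- by move=> d c Cd; exact: null_ideal_mull.
- by move=> d c Cd; exact: null_ideal_mulr.
- exact: null_ideal_closed.
Qed.

(** For z = x c y in C, z* z = E_C(z* z) <= |x|^2 E_C(y* c* c y), and the negative of the right-hand
    side is in the cone by [cone_EC]. *)
Lemma null_ideal_N2_C (x y : B) : N2 C EC (x, y) -> lrmul x y null_ideal `<=` null_ideal.
Proof.
move=> [_ hxy] _ [c [Cc hc] <-].
have Cz : C (x * c * y) by apply: hxy; exists c.
split=> //; have h := cone_EC y (CN (Cstar_mul Cc)) hc.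
have h' := cone_rsM (sqr_ge0 (cnorm x)) h.
apply: cone_le h'; rewrite -iotaB; apply/iota_accretive.
rewrite -(cexp_id hEC (d := star (x * c * y) * (x * c * y))); last exact: Cstar_mul.
rewrite -(cexp_rsM hEC) -(cexpN hEC) -(cexpB hEC); apply: (cexp_accretive C1 hEC).
have -> : - (star (x * c * y) * (x * c * y)) -
    rs B (cnorm x ^+ 2) * (star y * - (star c * c) * y) =
    star (c * y) * (rs B (cnorm x ^+ 2) - star x * x) * (c * y).
  by rewrite mulrBr rsC !starM; ncring.
by apply/accretive_conj/accretive_bound_star.
Qed.

Lemma theta0 : theta 0 = 0.
Proof.
have := semb_lin htheta (-1) (csub_0 hC) (csub_0 hC).
by rewrite !scaleN1r addr0 oppr0 addNr.
Qed.

Lemma thetaN c : C c -> theta (- c) = - theta c.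
Proof.
move=> Cc; have := semb_lin htheta (-1) Cc (csub_0 hC).
by rewrite !scaleN1r theta0 !addr0.
Qed.

(** The same inequality holds in theta(C); conjugation by u, which undoes theta, carries it back to
    C. *)
Lemma null_ideal_N2_Et (x y : B) : N2 (theta @` C) Et (x, y) ->
  lrmul x y (theta @` null_ideal) `<=` theta @` null_ideal.
Proof.
move=> [_ hxy] _ [_ [c [Cc hc] <-] <-].
have [d Cd hd] : (theta @` C) (x * theta c * y).
  by apply: hxy; exists (theta c) => //; exists c.
exists d => //; split=> //.
have [m Cm hm] := cexp_range hEt (star y * theta (- (star c * c)) * y).
have h := cone_rsM (sqr_ge0 (cnorm x)) (cone_Et (CN (Cstar_mul Cc)) Cm hm hc).
apply: cone_le h.
have e1 : star u * iota (star d * d) * u = iota (Et (star (x * theta c * y) * (x * theta c * y))).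
  rewrite ustar_iota_u; last exact: Cstar_mul.
  rewrite theta_mul //; last exact: csub_star hC _ Cd.
  rewrite theta_star // hd (cexp_id hEt) // -hd.
  exists (star d * d); first exact: Cstar_mul.
  by rewrite theta_mul ?theta_star //; exact: csub_star hC _ Cd.
have e2 : star u * iota m * u = iota (Et (star y * - (star (theta c) * theta c) * y)).
  rewrite ustar_iota_u // hm thetaN; last exact: Cstar_mul.
  by rewrite theta_mul ?theta_star //; exact: csub_star hC _ Cc.
have -> : iota (- (star d * d)) - iota (rs B (cnorm x ^+ 2) * m) =
   star (star u) * iota (Et (- (star (x * theta c * y) * (x * theta c * y)) -
     rs B (cnorm x ^+ 2) * (star y * - (star (theta c) * theta c) * y))) * star u.
  rewrite (cexpB hEt) (cexpN hEt) (cexp_rsM hEt) iotaB !iotaN -e1.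
  rewrite !(iotaM (rs B _)) -e2 starK !iota_rs.
  set p := iota (star d * d); set q := iota m; set r := rs A _.
  have -> : u * (- (star u * p * u) - r * (star u * q * u)) * star u =
    (u * star u) * - p * (u * star u) - u * r * star u * q * (u * star u) by ncring.
  by rewrite (rsC _ u) -(mulrA _ u) uK !mulr1 mul1r.
apply: accretive_conj; apply/iota_accretive; apply: (cexp_accretive D1 hEt).
have -> : - (star (x * theta c * y) * (x * theta c * y)) -
    rs B (cnorm x ^+ 2) * (star y * - (star (theta c) * theta c) * y) =
    star (theta c * y) * (rs B (cnorm x ^+ 2) - star x * x) * (theta c * y).
  by rewrite mulrBr rsC !starM; ncring.
by apply/accretive_conj/accretive_bound_star.
Qed.

Hypothesis hinv : forall C0 : set B, closed_ideal C C0 ->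
  (forall x y : B, N2 C EC (x, y) -> lrmul x y C0 `<=` C0) ->
  (forall x y : B, N2 (theta @` C) Et (x, y) ->
    lrmul x y (theta @` C0) `<=` theta @` C0) ->
  C0 = [set 0] \/ C0 = C.

Lemma null_ideal0 c : C c -> cone beta (- (star c * c)) -> c = 0.
Proof.
move=> Cc hc.
have [h|h] := hinv null_ideal_closed_ideal null_ideal_N2_C null_ideal_N2_Et.
  by have : null_ideal c by []; rewrite h.
have [_] : null_ideal 1 by rewrite h.
(* If N = C, then -1 is in the cone; with slack 1/2 this gives the inequality for -1/2 that
   [proper_ideal_beta] excludes. *)
rewrite star1 mulr1 => /(_ 2^-1 ltac:(by rewrite invr_gt0))[x [y [Jx hy hxy]]].
case: (proper_ideal_beta hJ J1 Jx hy (r := 2^-1)); first by rewrite invr_gt0.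
move: hxy; congr (accretive _); rewrite iotaN iota1.
have e := rs_midpoint (1 : A); rewrite !mulr1 in e.
by rewrite -e; ncring.
Qed.

(** The real part T of c is in the cone, hence so is n T n = - z^2, where n in C comes from the
    negative part of T. So z lies in the null ideal and vanishes. *)
Lemma accretive_cone c : C c -> cone beta c -> accretive c.
Proof.
move=> Cc hc; pose T := rs B 2^-1 * (c + star c).
have CT : C T by apply/(csub_rsM hC)/(csub_add hC) => //; exact: (csub_star hC).
have Ts : star T = T by rewrite star_rsM starD starK addrC.
have hT : cone beta T.
  apply: cone_le hc; rewrite -iotaB; apply/iota_accretive.
  rewrite /accretive starB Ts.
  have -> : T - c + (T - star c) = (T + T) - (c + star c) by ncring.
  by rewrite rs_midpoint subrr; exact: cpos0.
have [z [n [zs ns nTn zpos /(_ C hC CT)[Cz Cn]]]] := negative_part Ts.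
have z0 : z = 0.
  by apply: null_ideal0 => //; rewrite zs -nTn -{1}ns; exact: cone_C.
by rewrite /accretive -[c + _]rs_midpoint; exact: cposD (zpos z0) (zpos z0).
Qed.

(** * Compression along the axis of u *)

Lemma eBI x b0 : EB x = iota b0 -> eB x = b0.
Proof. by move=> h; apply: iota_inj; rewrite eBE. Qed.

Lemma eB_iota c : eB (iota c) = c.
Proof. by apply: eBI; exact: EB_iota. Qed.

Lemma eB0 x : EB x = 0 -> eB x = 0.
Proof. by move=> h; apply: eBI; rewrite iota0. Qed.

Lemma eBD x y : eB (x + y) = eB x + eB y.
Proof. by apply: eBI; rewrite iotaD !eBE (cexpD hEB). Qed.

Lemma eBZ (k : R[i]) x : eB (k *: x) = k *: eB x.
Proof. by apply: eBI; rewrite iotaZ !eBE (cexpZ hEB). Qed.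

Lemma eB_star x : eB (star x) = star (eB x).
Proof. by apply: eBI; rewrite iota_star eBE (cexp_star EB1 hEB). Qed.

Lemma eB_bimod c d x : eB (iota c * x * iota d) = c * eB x * d.
Proof. by apply: eBI; rewrite !iotaM eBE EB_bimod. Qed.

Definition psi x : B := EC (eB x).

Lemma psi_C x : C (psi x). Proof. exact: cexp_range hEC _. Qed.

Lemma psiD x y : psi (x + y) = psi x + psi y.
Proof. by rewrite /psi eBD (cexpD hEC). Qed.

Lemma psiZ (k : R[i]) x : psi (k *: x) = k *: psi x.
Proof. by rewrite /psi eBZ (cexpZ hEC). Qed.

Lemma psiN x : psi (- x) = - psi x.
Proof. by have := psiZ (-1) x; rewrite !scaleN1r. Qed.

Lemma psi_iota c : C c -> psi (iota c) = c.
Proof. by move=> Cc; rewrite /psi eB_iota (cexp_id hEC). Qed.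

Lemma psi_accretive x : accretive x -> accretive (psi x).
Proof.
move=> hx; apply: (cexp_accretive C1 hEC); apply/iota_accretive; rewrite eBE.
exact: (cexp_accretive EB1 hEB).
Qed.

Lemma rword_inv_right n e f w : rword n e f w ->
  (w = upow u f /\ e = f) \/
  exists m g d w', [/\ n = m.+1, compat g f d, rword m e g w' & w = w' * iota d * upow u f].
Proof.
move=> /rword_star/rword_inv[[h /negb_inj fe]|[m [g [d [w' [-> hd hw' h]]]]]].
  by left; split; rewrite ?fe // -[w]starK h star_upow negbK fe.
right; exists m, (~~ g), (star d), (star w'); split=> //.
- by have := compat_star hd; rewrite negbK.
- by have := rword_star hw'; rewrite negbK.
- by rewrite -[w]starK h !starM star_upow negbK iota_star mulrA.
Qed.

Lemma compat_ker c : compat false true (c - EC c).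
Proof. by split=> // _ _; exact: ker_EC. Qed.

(* Split the extreme letters of a word along B = ker E_C + C wherever they could
   cancel against u. *)
Lemma word_cases (V : A -> Prop) n e f w :
  (forall x y, V x -> V y -> V (x + y)) ->
  (forall d d', compat false e d -> compat f true d' -> V (iota d * w * iota d')) ->
  (forall c d', e = true -> C c -> compat f true d' -> V (iota c * w * iota d')) ->
  (forall d c', f = false -> C c' -> compat false e d -> V (iota d * w * iota c')) ->
  (forall c c', e = true -> f = false -> C c -> C c' -> V (iota c * w * iota c')) ->
  rword n e f w -> forall d d', V (iota d * w * iota d').
Proof.
move=> VD V1 V2 V3 V4 hw d d'.
have CE c : C (EC c) by exact: cexp_range hEC _.
have left_ d1 : (compat f true d1 \/ f = false /\ C d1) -> V (iota d * w * iota d1).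
  move=> h1; case: e hw V1 V2 V3 V4 => hw V1 V2 V3 V4.
    have -> : iota d * w * iota d1 =
      iota (d - EC d) * w * iota d1 + iota (EC d) * w * iota d1.
      by rewrite iotaB; ncring.
    apply: VD.
      by case: h1 => [h1|[f0 h1]]; [apply: V1 | apply: V3] => //; exact: compat_ker.
    by case: h1 => [h1|[f0 h1]]; [apply: V2 | apply: V4].
  by case: h1 => [h1|[f0 h1]]; [apply: V1 | apply: V3] => //; exact: compat_same.
case: f hw {V1 V2 V3 V4} left_ => hw left_.
  by apply: left_; left; exact: compat_same.
have -> : iota d * w * iota d' =
  iota d * w * iota (d' - EC d') + iota d * w * iota (EC d') by rewrite iotaB; ncring.
by apply: VD; apply: left_; [left; exact: compat_ker | right].
Qed.

Lemma rword_u_conj n f w c d : rword n true f w -> C c -> compat f true d ->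
  exists m g d' w', rword m g true w' /\
    star u * (iota c * w * iota d) * u = iota d' * w'.
Proof.
move=> hw Cc hd; case: (rword_inv hw) => [[-> _]|[m [g [d1 [w' [_ _ hw' ->]]]]]] /=.
  exists 0, true, (theta c * d), u; split; first exact: (rword1 true).
  by rewrite iotaM -(ustar_iota_u Cc); ncring.
exists (m + 0).+1, g, (theta c * d1), (w' * iota d * u); split.
  exact: (rword_cat hw' hd (rword1 true)).
by rewrite iotaM -(ustar_iota_u Cc); ncring.
Qed.

(** As u* c u = theta(c), the outer u and u* both cancel. Either the word was u d u* up to C, or two
    letters are lost, which is the decrease behind the induction in [eventually_rword]. *)
Lemma rword_u_conj2 n w c c' : rword n true false w -> C c -> C c' ->
  (exists2 d, Et d = 0 &
    star u * (iota c * w * iota c') * u = iota (theta c * d * theta c')) \/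
  exists m g h d d' w', [/\ (m.+1 < n)%N, rword m g h w' &
    star u * (iota c * w * iota c') * u = iota d * w' * iota d'].
Proof.
move=> hw Cc Cc'; case: (rword_inv hw) => [[_ //]|[m [g [d [w' [-> hd hw' ->]]]]]] /=.
case: (rword_inv_right hw') => [[-> ge]|[m' [h [d' [w'' [-> _ hw'' ->]]]]]] /=.
  left; exists d; first by rewrite ge in hd; case: hd => -> .
  by rewrite !iotaM -(ustar_iota_u Cc) -(ustar_iota_u Cc'); ncring.
right; exists m', g, h, (theta c * d), (d' * theta c'), w''; split=> //.
by rewrite !iotaM -(ustar_iota_u Cc) -(ustar_iota_u Cc'); ncring.
Qed.

Lemma alpha_EB0 x : alpha x -> EC (eB x) = 0.
Proof.
case=> [[k k0 <-]|[n [e [f [w [c [c' [hw _ _ ->]]]]]]]].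
  by rewrite eB_iota.
by rewrite eB0 ?(cexp0 hEC) // (word_EB0 _ _ hw).
Qed.

(** Conjugation by u* turns the edge group algebra C into theta(C). A word outside C becomes a word
    that [EB] kills or, if it was u d u* up to C, an element of ker E_theta. This is how psi x is
    recovered after compression. *)
Lemma Et_compress x : lspan words x -> Et (eB (star u * x * u)) = theta (psi x).
Proof.
elim=> {x} [x|| x y _ hx _ hy | k x _ hx]; last first.
- have := semb_lin htheta k (psi_C x) (csub_0 hC); rewrite theta0 !addr0 => e.
  by rewrite psiZ e -hx -scalerAr -scalerAl eBZ (cexpZ hEt).
- have := semb_lin htheta 1 (psi_C x) (psi_C y); rewrite !scale1r => e.
  by rewrite psiD e -hx -hy mulrDr mulrDl eBD (cexpD hEt).
- have p0 : psi 0 = 0 by rewrite /psi eB0 ?(cexp0 hEC) // (cexp0 hEB).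
  by rewrite p0 theta0 mulr0 mul0r eB0 ?(cexp0 hEt) // (cexp0 hEB).
case=> [[c _ <-]|[n [e [f [w [c [c' [hw _ _ ->]]]]]]]].
  have Cc : C (EC c) by exact: cexp_range hEC _.
  have -> : star u * iota c * u = star u * iota (c - EC c) * u + iota (theta (EC c)).
    by rewrite iotaB -(ustar_iota_u Cc); ncring.
  rewrite eBD (cexpD hEt) eB_iota (cexp_id hEt (d := theta (EC c))); last by exists (EC c).
  rewrite eB0 ?(cexp0 hEt) ?add0r /psi ?eB_iota //.
  apply: (@rword_EB0 1 false true); apply: (rwordS (e := false) _ (rword1 true)).
  exact: compat_ker.
rewrite /psi [in RHS]eB0 ?(cexp0 hEC) ?theta0; last exact: word_EB0 hw.
have EB_ e' f' v m d d' : rword m e' f' v -> Et (eB (iota d * v * iota d')) = 0.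
  by move=> hv; rewrite eB0 ?(cexp0 hEt) // (word_EB0 _ _ hv).
move: c c'; apply: (@word_cases (fun x => Et (eB (star u * x * u)) = 0) n e f w) => //.
- by move=> y z hy hz; rewrite mulrDr mulrDl eBD (cexpD hEt) hy hz addr0.
- move=> d d' hd hd'.
  have [|m hm] := @rword_ustar_alpha (iota d * w * iota d').
    by right; exists n, e, f, w, d, d'.
  by rewrite eB0 ?(cexp0 hEt) // (rword_EB0 hm).
- move=> d d' e1 Cd hd'; rewrite e1 in hw.
  have [m [g [d1 [w' [hw' ->]]]]] := rword_u_conj hw Cd hd'.
  by rewrite -[iota d1 * w']mulr1 -iota1; exact: EB_ hw'.
- move=> d d' f0 Cd' hd.
  have hw' := rword_star hw; rewrite f0 in hw'.
  have [m [g [d1 [w' [hw'' h]]]]] := rword_u_conj hw' (csub_star hC Cd') (compat_star hd).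
  have -> : star u * (iota d * w * iota d') * u =
      star (star u * (iota (star d') * star w * iota (star d)) * u).
    by rewrite !starM !iota_star !starK; ncring.
  rewrite h eB_star (cexp_star D1 hEt) -[iota d1 * w']mulr1 -iota1.
  by rewrite (EB_ _ _ _ _ _ _ hw'') star0.
- move=> d d' e1 f0 Cd Cd'; rewrite e1 f0 in hw.
  have [[d1 h1 ->]|[m [g [h [d1 [d2 [w' [_ hw' ->]]]]]]]] := rword_u_conj2 hw Cd Cd'.
    by rewrite eB_iota (cexp_bimod hEt) ?h1 ?mulr0 ?mul0r //; eexists.
  exact: EB_ hw'.
Qed.

(** * Positive words and the effect of repeated compression *)

Inductive pword : A -> Prop :=
  | pword1 : pword u
  | pwordS c w : pword w -> pword (u * iota c * w).

Lemma pword_rword w : pword w -> exists n, rword n true true w.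
Proof.
elim=> [|c {}w _ [n hn]]; first by exists 0; exact: (rword1 true).
by exists n.+1; apply: (rwordS _ hn); exact: compat_same.
Qed.

Lemma pword_rcons w c : pword w -> pword (w * iota c * u).
Proof.
elim=> [|d {}w _ IH]; first exact: pwordS pword1.
by rewrite -2!mulrA (mulrA w); exact: pwordS.
Qed.

Definition positive : set A :=
  [set x | exists w c d, pword w /\ x = iota c * w * iota d].

(* Positive words are translations along the axis of u, which compressing by
   powers of u never turns into elements of alpha. *)
Definition gamma : set A := [set x | [\/ alpha x, positive x | positive (star x)]].

Lemma alpha_star x : alpha x -> alpha (star x).
Proof.
case=> [[c c0 <-]|[n [e [f [w [c [d [hw hc hd ->]]]]]]]].
  by left; exists (star c); [exact: EC_star0 | rewrite iota_star].
right; exists n, (~~ f), (~~ e), (star w), (star d), (star c); split.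
- exact: rword_star.
- by have := compat_star hd.
- by have := compat_star hc.
- by rewrite !starM !iota_star mulrA.
Qed.

Lemma gamma_star x : gamma x -> gamma (star x).
Proof.
case=> h; [apply: Or31; exact: alpha_star | apply: Or33; rewrite starK // | exact: Or32].
Qed.

Lemma beta_star x : beta x -> beta (star x).
Proof.
move=> [n [e [f [v [c [c' [hv [ee Cc] [fe Cc'] ->]]]]]]]; subst e f.
exists n, true, false, (star v), (star c'), (star c); split.
- exact: rword_star hv.
- by split=> //; exact: csub_star hC _ Cc'.
- by split=> //; exact: csub_star hC _ Cc.
- by rewrite !starM !iota_star mulrA.
Qed.

(** Only the left junction u* c u can cancel. Split c along ker E_C + C: the first part gives a
    reduced word, the second merges into a letter between two u's. Either way the result starts with
    u and ends with u b* u*, where b* is in ker E_theta. *)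
Lemma positive_ubu x : positive x -> lspan beta (ubu * x * star ubu).
Proof.
move=> [w [c [d [hw ->]]]].
have Cc : C (EC c) by exact: cexp_range hEC _.
have sb : Et (star b) = 0 by exact: EtN0.
have tail n v : rword n true true v ->
    lspan beta (v * iota d * (u * iota (star b) * star u)).
  move=> hv; apply/lspan_in/(@beta_rword (n + 1).+1).
  apply: (rword_cat hv (compat_same _ _)).
  by apply: (rwordS (e := true) _ (rword1 false)); split.
have [n hn] := pword_rword hw; rewrite star_ubu.
have -> : ubu * (iota c * w * iota d) * (u * iota (star b) * star u) =
    u * iota b * (star u * iota (c - EC c) * w) * iota d * (u * iota (star b) * star u)
    + ubu * (iota (EC c) * w * iota d) * (u * iota (star b) * star u).
  by rewrite /ubu iotaB; ncring.
apply: lspanD.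
  apply: (tail n.+2); apply: (rwordS (e := true) (g := false)); first by split.
  by apply: (rwordS (e := false) _ hn); exact: compat_ker.
case: hw => [|d1 {hn}w /pword_rword[m hm]].
  have -> : ubu * (iota (EC c) * u * iota d) = u * iota (b * theta (EC c) * d).
    by rewrite /ubu !iotaM -(ustar_iota_u Cc); ncring.
  apply/lspan_in/(@beta_rword 2); rewrite 2!mulrA.
  have -> : u * iota (b * theta (EC c) * d) * u * iota (star b) * star u =
    u * iota (b * theta (EC c) * d) * (u * iota (star b) * star u) by ncring.
  apply: (rwordS (e := true) (compat_same _ _)).
  by apply: (rwordS (e := true) _ (rword1 false)); split.
have -> : ubu * (iota (EC c) * (u * iota d1 * w) * iota d) =
    u * iota (b * theta (EC c) * d1) * w * iota d.
  by rewrite /ubu !iotaM -(ustar_iota_u Cc); ncring.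
by apply: (tail m.+1); apply: (rwordS _ hm); exact: compat_same.
Qed.

Lemma gamma_ubu x : lspan gamma x -> lspan beta (ubu * x * star ubu).
Proof.
apply: lspan_mul => {}x [hx|hx|hx].
- by rewrite star_ubu; apply/lspan_in/beta_u_conj => //; exact: EtN0.
- exact: positive_ubu.
- have -> : ubu * x * star ubu = star (ubu * star x * star ubu).
    by rewrite !(starM _ (star ubu), starM ubu) !starK mulrA.
  by apply: lspan_star (positive_ubu hx) => y hy; exact/lspan_in/beta_star.
Qed.

Lemma gamma_psi x : lspan gamma x -> psi x = 0.
Proof.
have pos y : positive y -> EB y = 0.
  by move=> [w [c [d [/pword_rword[n hn] ->]]]]; exact: word_EB0 hn.
elim=> {x} [x [hx|/pos hx|/pos hx]||x y _ hx _ hy|k x _ hx].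
- exact: alpha_EB0.
- by rewrite /psi eB0 ?(cexp0 hEC).
- by rewrite /psi -[x]starK eB_star eB0 ?star0 ?(cexp0 hEC).
- by rewrite /psi eB0 ?(cexp0 hEC) // (cexp0 hEB).
- by rewrite psiD hx hy addr0.
- by rewrite psiZ hx scaler0.
Qed.

(* Moving the base edge one step forward along the axis of u. *)
Definition step d x : A := iota (star d) * (star u * x * u) * iota d.

(** Every letter d is allowed at each step because removing a step uses the nondegeneracy of E_C,
    which tests against all d. *)
Fixpoint eventually n x : Prop :=
  if n is n'.+1 then forall d, eventually n' (step d x)
  else exists2 c, C c & lspan gamma (x - iota c).

Lemma stepE d x : step d x = (iota (star d) * star u) * x * (u * iota d).
Proof. by rewrite /step; ncring. Qed.

Lemma stepD d x y : step d (x + y) = step d x + step d y.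
Proof. by rewrite !stepE mulrDr mulrDl. Qed.

Lemma stepB d x y : step d (x - y) = step d x - step d y.
Proof. by rewrite !stepE mulrBr mulrBl. Qed.

Lemma stepZ d (k : R[i]) x : step d (k *: x) = k *: step d x.
Proof. by rewrite !stepE -scalerAr -scalerAl. Qed.

Lemma step_star d x : step d (star x) = star (step d x).
Proof. by rewrite /step !starM starK !iota_star starK; ncring. Qed.

Lemma eventuallyD n x y : eventually n x -> eventually n y -> eventually n (x + y).
Proof.
elim: n x y => [|n IH] x y /=; last first.
  by move=> hx hy d; rewrite stepD; exact: IH.
move=> [c Cc hc] [d Cd hd]; exists (c + d); first exact: csub_add hC _ _ Cc Cd.
have -> : x + y - iota (c + d) = x - iota c + (y - iota d) by rewrite iotaD; ncring.
exact: lspanD.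
Qed.

Lemma eventuallyZ n (k : R[i]) x : eventually n x -> eventually n (k *: x).
Proof.
elim: n x => [|n IH] x /=; last by move=> hx d; rewrite stepZ; exact: IH.
move=> [c Cc hc]; exists (k *: c); first exact: csub_scale hC _ _ Cc.
by rewrite iotaZ -scalerBr; exact: lspanZ.
Qed.

Lemma eventually_star n x : eventually n x -> eventually n (star x).
Proof.
elim: n x => [|n IH] x /=; last by move=> hx d; rewrite step_star; exact: IH.
move=> [c Cc hc]; exists (star c); first exact: csub_star hC _ Cc.
rewrite iota_star -starB; apply: lspan_star hc => y /gamma_star; exact: lspan_in.
Qed.

Lemma eventually_gamma x : gamma x -> eventually 0 x.
Proof. by exists 0; [exact: csub_0 hC | rewrite iota0 subr0; exact: lspan_in]. Qed.

Lemma eventually_iota c : eventually 0 (iota c).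
Proof.
exists (EC c); first exact: cexp_range hEC _.
rewrite -iotaB; apply/lspan_in/Or31; left; eexists; last by [].
exact: ker_EC.
Qed.

Lemma alpha_rword n e f w c d : rword n e f w -> compat false e c ->
  compat f true d -> alpha (iota c * w * iota d).
Proof. by move=> hw hc hd; right; exists n, e, f, w, c, d. Qed.

Lemma step_alpha d x : alpha x -> alpha (step d x).
Proof. by move=> /rword_ustar_alpha[n hn]; apply: (alpha_rword hn); exact: compat_same. Qed.

Lemma step_positive d x : positive x -> eventually 0 (step d x).
Proof.
move=> [w [c [c' [hw ->]]]]; have [n hn] := pword_rword hw.
have Cc : C (EC c) by exact: cexp_range hEC _.
have -> : iota c * w * iota c' =
  iota (c - EC c) * w * iota c' + iota (EC c) * w * iota c' by rewrite iotaB; ncring.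
rewrite stepD; apply: eventuallyD; apply: eventually_gamma.
  by apply/Or31/step_alpha/(alpha_rword hn); [exact: compat_ker | exact: compat_same].
apply: Or32; case: hw => [|d1 {hn}w hw].
  exists u, (star d * theta (EC c) * c'), d; split; first exact: pword1.
  by rewrite /step !iotaM -(ustar_iota_u Cc); ncring.
exists (w * iota c' * u), (star d * theta (EC c) * d1), d.
by split; [exact: pword_rcons | rewrite /step !iotaM -(ustar_iota_u Cc); ncring].
Qed.

(** C plus the span of gamma is stable under [step]: alpha goes to alpha, and a positive word splits
    into an alpha part and a part that loses its first u but gains one at the end. *)
Lemma eventuallyS n x : eventually n x -> eventually n.+1 x.
Proof.
elim: n x => [|n IH] x; last by move=> hx d; exact/IH/hx.
move=> [c Cc hc] d; change (eventually 0 (step d x)).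
have -> : step d x = iota (star d * theta c * d) + step d (x - iota c).
  by rewrite stepB /step !iotaM -(ustar_iota_u Cc); ncring.
apply: eventuallyD; first exact: eventually_iota.
rewrite stepE; apply: (lspan_map (phi := id) (V := eventually 0)
  (f := fun y => iota (star d) * star u * y * (u * iota d))) hc.
- by rewrite -iota0; exact: eventually_iota.
- by move=> y z; exact: eventuallyD.
- by move=> k y; exact: eventuallyZ.
- by move=> y z; rewrite mulrDr mulrDl.
- by move=> k y; rewrite -scalerAr -scalerAl.
move=> y; rewrite -stepE; case=> hy.
- exact/eventually_gamma/Or31/step_alpha.
- exact: step_positive.
- by rewrite -[y]starK step_star; apply: eventually_star; exact: step_positive.
Qed.

Lemma eventually_le n m x : (n <= m)%N -> eventually n x -> eventually m x.
Proof.
by move=> /subnK <-; elim: (m - n)%N => // k IH hx; apply: eventuallyS; exact: IH.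
Qed.

(* The words starting with m + 1 letters u followed by a u^*. *)
Inductive run : nat -> A -> Prop :=
  | run0 n f c w d : Et c = 0 -> rword n false f w -> compat f true d ->
      run 0 (u * iota c * (w * iota d))
  | runS m c v : run m v -> run m.+1 (u * iota c * v).

Lemma run_rcons m v d : run m v -> run m (v * (u * iota d)).
Proof.
elim=> {m v} [n f c w c' c0 hw hc|m c v _ IH]; last first.
  by rewrite -mulrA; exact: runS.
have -> : u * iota c * (w * iota c') * (u * iota d) =
  u * iota c * ((w * iota c' * u) * iota d) by ncring.
apply: (run0 c0 (rword_cat hw hc (rword1 true))); exact: compat_same.
Qed.

Lemma run_word m v : run m v -> exists n f w d,
  [/\ rword n true f w, compat f true d & v = w * iota d].
Proof.
elim=> {m v} [n f c w d c0 hw hd|m c v _ [n [f [w [d [hw hd ->]]]]]].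
  exists n.+1, f, (u * iota c * w), d; split; rewrite ?mulrA //.
  by apply: (rwordS (e := true) _ hw); split.
exists n.+1, f, (u * iota c * w), d; split; rewrite ?mulrA //.
by apply: (rwordS (e := true) _ hw); exact: compat_same.
Qed.

Lemma eventually_run m v c : C c -> run m v -> eventually m.+1 (iota c * v).
Proof.
(* A step removes one leading u but leaves an arbitrary letter of B in front; its component in ker
   E_C already gives an alpha word, so only the component in C matters. *)
have ind k w d : (forall c1, C c1 -> eventually k.+1 (iota c1 * w)) -> run k w ->
    eventually k.+1 (iota d * w).
  move=> h hw; have -> : iota d * w = iota (d - EC d) * w + iota (EC d) * w.
    by rewrite iotaB; ncring.
  apply: eventuallyD; last by apply: h; exact: cexp_range hEC _.
  have [n [f [v' [d' [hv' hd' ->]]]]] := run_word hw.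
  apply: (eventually_le (n := 0)) => //; apply: eventually_gamma; apply: Or31.
  by rewrite mulrA; apply: (alpha_rword hv') => //; exact: compat_ker.
elim: m v c => [|m IH] v c Cc hv d.
  inversion_clear hv as [n f c1 w d1 c10 hw hd1|].
  have -> : step d (iota c * (u * iota c1 * (w * iota d1))) =
      iota (star d * theta c * c1) * (w * iota d1 * u) * iota d.
    by rewrite /step !iotaM -(ustar_iota_u Cc); ncring.
  apply/eventually_gamma/Or31/(alpha_rword (rword_cat hw hd1 (rword1 true)));
    exact: compat_same.
inversion hv as [|m' c1 v' hv' e1 e2]; subst.
have -> : step d (iota c * (u * iota c1 * v')) =
    iota (star d * theta c * c1) * (v' * (u * iota d)).
  by rewrite /step !iotaM -(ustar_iota_u Cc); ncring.
apply: ind; last exact: run_rcons.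
by move=> e Ce; apply: IH => //; exact: run_rcons.
Qed.

Lemma pword_or_run n e f w d : rword n e f w -> e = true -> compat f true d ->
  pword w \/ exists2 m, (m < n)%N & run m (w * iota d).
Proof.
elim=> {n e f w} [e ->|n e g f c w hc hw IH et] hd; first by left; exact: pword1.
rewrite et in hc *; case: g hc hw IH => hc hw IH.
  case: (IH erefl hd) => [pw|[m mn hm]]; first by left; exact: pwordS.
  by right; exists m.+1; rewrite // -mulrA; exact: runS.
right; exists 0 => //; rewrite -mulrA; apply: (run0 _ hw hd).
by case: hc => ->.
Qed.

(** Only a word with both outer letters in C needs the induction: there a step shortens it. If just
    the left one is in C, the word is positive or a run; the remaining one-sided case is the adjoint
    of this. *)
Lemma eventually_rword n e f w c d : rword n e f w ->
  eventually n.+1 (iota c * w * iota d).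
Proof.
elim/ltn_ind: n e f w c d => n IH e f w c d hw.
have CA m g w' c' d' : rword m true g w' -> C c' -> compat g true d' ->
    eventually m.+1 (iota c' * w' * iota d').
  move=> hw' Cc' hd'; case: (pword_or_run hw' erefl hd') => [pw|[k km hk]].
    apply: (eventually_le (n := 0)) => //; apply/eventually_gamma/Or32.
    by exists w', c', d'.
  by rewrite -mulrA; apply: eventually_le (eventually_run Cc' hk); exact: ltnW km.
apply: (@word_cases (eventually n.+1) n e f w) => //
  [x y|d1 d2 h1 h2|d1 d2 e1|d1 d2 f1|d1 d2 e1 f1].
- exact: eventuallyD.
- by apply: (eventually_le (n := 0)) => //; apply/eventually_gamma/Or31/(alpha_rword hw).
- by rewrite e1 in hw; exact: CA hw.
- move=> Cd2 hd1; rewrite f1 in hw.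
  have -> : iota d1 * w * iota d2 = star (iota (star d2) * star w * iota (star d1)).
    by rewrite !starM !iota_star !starK mulrA.
  apply/eventually_star/CA; [exact: (rword_star hw) | exact: csub_star hC _ Cd2 |].
  exact: (compat_star hd1).
- move=> Cd1 Cd2 x; rewrite e1 f1 in hw.
  rewrite /step.
  have [[d3 _ ->]|[m [g [h [d3 [d4 [w' [mn hw' ->]]]]]]]] := rword_u_conj2 hw Cd1 Cd2.
    rewrite -!iotaM; apply: (eventually_le (n := 0)) => //; exact: eventually_iota.
  have -> : iota (star x) * (iota d3 * w' * iota d4) * iota x =
    iota (star x * d3) * w' * iota (d4 * x) by rewrite !iotaM; ncring.
  by apply: eventually_le (ltnW mn) _; apply: IH hw'; exact: ltnW mn.
Qed.

Lemma eventually_words x : lspan words x -> exists n, eventually n x.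
Proof.
elim=> {x} [x [[c _ <-]|[n [e [f [w [c [d [hw _ _ ->]]]]]]]]||x y _ [n hn] _ [m hm]
  |k x _ [n hn]].
- by exists 0; exact: eventually_iota.
- by exists n.+1; exact: eventually_rword hw.
- by exists 0; rewrite -iota0; exact: eventually_iota.
- exists (maxn n m); apply: eventuallyD.
    by apply: eventually_le hn; exact: leq_maxl.
  by apply: eventually_le hm; exact: leq_maxr.
- by exists n; exact: eventuallyZ.
Qed.

(** For n = 0, conjugating by u b u* fixes c and sends the gamma part to beta, so c = psi x is in
    the cone. For n + 1, the induction hypothesis says that E_C(d* y d) is accretive for all d,
    where y = E_B(u* x u). Nondegeneracy gives it for y, hence for E_theta(y) = theta(psi x), and
    conjugation by u for psi x. *)
Lemma eventually_accretive n x (j : A) : eventually n x -> lspan words x -> J j ->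
  accretive (x - j) -> accretive (psi x).
Proof.
elim: n x j => [|n IH] x j hx wx Jj hxj.
  have [c Cc hc] := hx.
  have -> : psi x = c.
    by rewrite -[x](subrK (iota c)) psiD psi_iota // gamma_psi // add0r.
  apply: accretive_cone => // r r0.
  exists (ubu * j * star ubu), (- (ubu * (x - iota c) * star ubu)); split.
  - exact: ideal_conj.
  - exact/lspanN/gamma_ubu.
  have := accretiveD (accretive_conj (star ubu) hxj) (accretive_rs A (ltW r0)).
  rewrite starK; congr (accretive _); rewrite -{1}(ubu_conjC Cc); ncring.
have ws d : lspan words (step d x).
  rewrite /step; apply: lspan_words_mul; last exact/lspan_in/words_iota.
  apply: lspan_words_mull_iota; apply: lspan_words_mul; last exact: lspan_words_u.
  exact: (lspan_words_mull_upow false).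
have hstep d : accretive (psi (step d x)).
  apply: (IH _ (step d j)) => //; first by rewrite stepE; exact: ideal_conj.
  rewrite -stepB stepE.
  have -> : iota (star d) * star u = star (u * iota d) by rewrite starM iota_star.
  exact: accretive_conj.
have hY : accretive (eB (star u * x * u)).
  apply: (nondegenerate_accretive C1 hEC hECnd) => d.
  by have := hstep d; rewrite /psi /step eB_bimod.
have := cexp_accretive D1 hEt hY; rewrite Et_compress // => /iota_accretive h.
apply/iota_accretive; rewrite -(hnn_A hA (psi_C x)) -{1}[u]starK.
exact: accretive_conj.
Qed.

(** Since x is only a limit of combinations z of words, the previous lemma is applied to -z + r / 2,
    which exceeds -x in real part modulo nothing but the error x - z. *)
Lemma ideal_psi_accretive x : J x -> accretive (- psi x).
Proof.
move=> Jx; apply: accretive_lim => r r0; have r2 : 0 < r / 2 by rewrite divr_gt0.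
have [z wz xz] := lspan_words_dense x r2.
pose y := - z + rs A (r / 2).
have wy : lspan words y.
  apply: lspanD; first exact: lspanN.
  by rewrite -iota_rs; exact/lspan_in/words_iota.
have [n hn] := eventually_words wy.
have h1 : accretive (psi y).
  apply: (eventually_accretive hn wy (j := - x)).
    by rewrite -scaleN1r; exact: idealZ.
  have -> : y - - x = rs A (r / 2) + (x - z) by rewrite /y; ncring.
  by apply: accretive_bound; exact: ltW.
have h2 : accretive (psi (rs A (r / 2) + (z - x))).
  by apply/psi_accretive/accretive_bound; rewrite cnormBC; exact: ltW.
have Crs q : C (rs B q) by rewrite -[rs B q]mulr1; apply: (csub_rsM hC).
have -> : - psi x + rs B r = psi y + psi (rs A (r / 2) + (z - x)).
  have -> : rs B r = rs B (r / 2) + rs B (r / 2) by rewrite -rsD -splitr.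
  by rewrite /y !psiD !psiN -iota_rs psi_iota //; ncring.
exact: accretiveD.
Qed.

(** Using x and -x kills the real part of psi x, and i x and -i x the imaginary part. *)
Lemma ideal_psi0 x : J x -> psi x = 0.
Proof.
have skew y : J y -> psi y + star (psi y) = 0.
  move=> Jy; apply: cpos_anti.
    have := ideal_psi_accretive (idealZ (-1) Jy).
    by rewrite scaleN1r psiN opprK.
  have := ideal_psi_accretive Jy; rewrite /accretive starN; congr (cpos _); ncring.
move=> Jx; have h1 := skew _ Jx; have := skew _ (idealZ 'i Jx).
rewrite psiZ starZ conjCi scaleNr -scalerBr => /eqP.
rewrite scaler_eq0 (negPf (neq0Ci _)) /= subr_eq0 => /eqP h2.
by rewrite -(rs_half (psi x)) {2}h2 h1 mulr0.
Qed.

Lemma ideal_eq0 x : J x -> x = 0.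
Proof.
have EB_J y : J y -> EB y = 0.
  move=> Jy; suff y0 : eB y = 0 by rewrite -eBE y0 iota0.
  apply: hECnd => d.
  (* Multiplying y by elements of B on both sides stays in J and turns psi into E_C(d* E_B(y)*
     E_B(y) d). *)
  have := ideal_psi0 (ideal_conj (iota (star d * star (eB y))) (iota d) Jy).
  by rewrite /psi eB_bimod.
move=> Jx; apply: (hnn_nondeg hA) => v; apply: EB_J.
rewrite -mulrA -[_ * _ * (x * v)]mulr1 mulrA.
have -> : star v * star x * x * v * 1 = (star v * star x) * x * v by ncring.
exact: ideal_conj.
Qed.

End ProperIdeal.

End Words.

Theorem proposition3p11 (R : realType) (B A : cstarAlgType R) (C : set B)
    (theta EC Etheta : B -> B) (iota : B -> A) (EB : A -> A) (u : A)
    (hC : unital_cstar_subalgebra C)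
    (htheta : unital_star_embedding C theta)
    (hEC : cond_exp C EC) (hECnd : nondegenerate_cexp EC)
    (hEtheta : cond_exp (theta @` C) Etheta)
    (hEthetand : nondegenerate_cexp Etheta)
    (hA : reduced_HNN C EC theta Etheta iota EB u)
    (a b : B) (hau : unitary a) (hbu : unitary b)
    (haC : commutant C a) (hbC : commutant (theta @` C) b)
    (ha0 : EC a = 0) (hb0 : Etheta b = 0)
    (hab : lrmul a (star a) (Ker EC) `<=` Ker EC \/
           lrmul b (star b) (Ker Etheta) `<=` Ker Etheta)
    (hinv : forall C0 : set B, closed_ideal C C0 ->
       (forall x y : B, N2 C EC (x, y) -> lrmul x y C0 `<=` C0) ->
       (forall x y : B, N2 (theta @` C) Etheta (x, y) ->
          lrmul x y (theta @` C0) `<=` theta @` C0) ->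
       C0 = [set 0] \/ C0 = C) :
  cstar_simple A.
Proof.
move=> J hJ; have [J1|J1] := pselect (J 1).
  by right; apply/seteqP; split=> // x _; rewrite -[x]mulr1; exact: (ideal_mull hJ).
left; apply/seteqP; split=> [x|_ ->]; last exact: ideal_0 hJ.
exact: (ideal_eq0 hC htheta hEC hECnd hEtheta hA hau haC ha0 hbu hbC hb0 hJ J1 hinv).
Qed.
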